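(* Let $X\subseteq\mathbb{P}^{n+2}$ be an $n$-dimensional smooth complete intersection of two hyperquadrics $X_{1}$ and $X_{2}$. (i) $X$ does not contain any quadric of dimension $m=[\frac{n}{2}]+1$. (ii) If $n$ is even and $m=\frac{n}{2}$, then for a general point $x\in X$ there is an $m$-dimensional quadric $Q_{x}$ satisfying $x\in Q_{x}\subseteq X$. (iii) Assume $n\geq 3$. Let $x_{0}\in X$ be an arbitrary fixed point and let $m=[\frac{n-1}{2}]$. Then for a general point $x\in X$ there is an $m$-dimensional quadric $Q_{x}$ satisfying $x_{0},x\in Q_{x}\subseteq X$.
   Context: The base field is $\mathbb{C}$; all varieties are irreducible (in particular $X$ is irreducible). $[a]$ denotes the integer part of $a$. A hyperquadric is a hypersurface of degree 2 in projective space. An $m$-dimensional quadric in $\mathbb{P}^{n+2}$ is an (irreducible, reduced, possibly singular) hypersurface of degree 2 in some $(m+1)$-dimensional linear subspace of $\mathbb{P}^{n+2}$. ''$X$ is a complete intersection of $X_1$ and $X_2$'' means that $X$ has codimension 2 and is the scheme-theoretic intersection of $X_1$ and $X_2$. *)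

(* Defs.v *)
From HB Require Import structures.
From mathcomp Require Import all_boot all_order all_algebra.
From mathcomp Require Import complex.
From mathcomp Require Import classical_sets reals.
From mathcomp Require Import mpoly.

Set Implicit Arguments.
Unset Strict Implicit.
Unset Printing Implicit Defensive.

Import Order.TTheory GRing.Theory Num.Theory.
Local Open Scope classical_set_scope.
Local Open Scope ring_scope.

(* A point of P^N is given by a vector of homogeneous coordinates. Proportional
   vectors are different inhabitants of [ppoint K N], but all the subsets of
   P^N considered below are zero loci of homogeneous polynomials or images of
   such loci under linear maps, hence stable under rescaling. *)
Definition ppoint (K : closedFieldType) (N : nat) :=
  {v : 'rV[K]_N.+1 | v != 0}.

Definition peval (K : closedFieldType) (N : nat)
    (p : {mpoly K[N.+1]}) (x : ppoint K N) : K :=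
  p.@[fun i => val x 0 i].

Definition zariski_closed (K : closedFieldType) (N : nat)
    (Z : set (ppoint K N)) : Prop :=
  exists S : set {mpoly K[N.+1]},
    (forall p, S p -> exists d, p \is d.-homog) /\
    (forall x, Z x <-> forall p, S p -> peval p x = 0).

Definition variety (K : closedFieldType) (N : nat)
    (Z : set (ppoint K N)) : Prop :=
  [/\ zariski_closed Z, Z !=set0 &
      forall A B : set (ppoint K N), zariski_closed A -> zariski_closed B ->
        Z `<=` A `|` B -> Z `<=` A \/ Z `<=` B].

Definition variety_chain (K : closedFieldType) (N : nat)
    (Z : set (ppoint K N)) (d : nat) (c : nat -> set (ppoint K N)) : Prop :=
  [/\ forall i, (i <= d)%N -> variety (c i),
      forall i, (i < d)%N -> c i `<` c i.+1 &
      c d `<=` Z].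

(* Krull dimension of the topological space Z. *)
Definition has_dim (K : closedFieldType) (N : nat)
    (Z : set (ppoint K N)) (d : nat) : Prop :=
  (exists c, variety_chain Z d c) /\
  (forall e c, variety_chain Z e c -> (e <= d)%N).

(* For a zero locus X, which is stable under rescaling, this is the homogeneous
   ideal of X: since K is infinite, if p vanishes at all coordinate vectors of
   the points of X, so do the homogeneous components of p. *)
Definition vanishing_ideal (K : closedFieldType) (N : nat)
    (X : set (ppoint K N)) : set {mpoly K[N.+1]} :=
  [set p | forall x, X x -> peval p x = 0].

(* The space of w such that dp_x(w) = 0 for all p in I(X). It is the tangent
   space at x of the affine cone over X, so its dimension is one more than that
   of the Zariski tangent space of X at x. *)
Definition cone_tangent (K : closedFieldType) (N : nat)
    (X : set (ppoint K N)) (x : ppoint K N) : set 'rV[K]_N.+1 :=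
  [set w | forall p, vanishing_ideal X p ->
             \sum_(i < N.+1) peval (p^`M(i)) x * w 0 i = 0].

Definition smooth (K : closedFieldType) (N : nat)
    (X : set (ppoint K N)) : Prop :=
  exists2 d, has_dim X d &
    forall x, X x ->
      exists2 T : {vspace 'rV[K]_N.+1},
        forall w, w \in T <-> cone_tangent X x w & \dim T = d.+1.

(* A hyperquadric, as a subscheme of P^N, is given by its equation. *)
Definition hyperquadric_eqn (K : closedFieldType) (N : nat)
    (F : {mpoly K[N.+1]}) : Prop :=
  F != 0 /\ F \is 2.-homog.

(* Saturation of (F1, F2) with respect to the irrelevant ideal. *)
Definition saturation2 (K : closedFieldType) (N : nat)
    (F1 F2 : {mpoly K[N.+1]}) : set {mpoly K[N.+1]} :=
  [set p | exists k, forall m : 'X_{1..N.+1}, mdeg m = k ->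
     exists a b : {mpoly K[N.+1]}, 'X_[m] * p = a * F1 + b * F2].

(* Two homogeneous ideals define the same closed subscheme of P^N if and only
   if they have the same saturation, and the ideal of a (reduced) closed set X
   is saturated. *)
Definition scheme_intersection (K : closedFieldType) (N : nat)
    (X : set (ppoint K N)) (F1 F2 : {mpoly K[N.+1]}) : Prop :=
  forall p, vanishing_ideal X p <-> saturation2 F1 F2 p.

Definition complete_intersection (K : closedFieldType) (n : nat)
    (X : set (ppoint K n.+2)) (F1 F2 : {mpoly K[n.+3]}) : Prop :=
  has_dim X n /\ scheme_intersection X F1 F2.

Definition irreducible_mpoly (K : closedFieldType) (k : nat)
    (p : {mpoly K[k]}) : Prop :=
  p \isn't a GRing.unit /\
  forall a b : {mpoly K[k]}, p = a * b ->
    a \is a GRing.unit \/ b \is a GRing.unit.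

(* The rows of A span an (m+1)-dimensional linear subspace of P^N, on which u
   are homogeneous coordinates; g is the equation in it of a hypersurface of
   degree 2, which is irreducible and reduced if and only if g is irreducible. *)
Definition quadric (K : closedFieldType) (N m : nat)
    (Q : set (ppoint K N)) : Prop :=
  exists (A : 'M[K]_(m.+2, N.+1)) (g : {mpoly K[m.+2]}),
    [/\ row_free A, g \is 2.-homog, irreducible_mpoly g &
        forall x, Q x <->
          exists2 u : 'rV[K]_m.+2, val x = u *m A & g.@[fun i => u 0 i] = 0].

(* P holds on a nonempty Zariski open subset of the irreducible X. *)
Definition for_general_point (K : closedFieldType) (N : nat)
    (X P : set (ppoint K N)) : Prop :=
  exists Z : set (ppoint K N),
    [/\ zariski_closed Z, ~ (X `<=` Z) & forall x, X x -> ~ Z x -> P x].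

(* Main.v *)
Require Import Defs.
From mathcomp Require Import all_boot all_order all_algebra.
From mathcomp Require Import complex.
From mathcomp Require Import boolp classical_sets reals.
From mathcomp Require Import mpoly.
From mathcomp Require Import ring zify.

(** Write the two hyperquadrics as symmetric matrices f and g, so that X is the
    set of common zeros of the forms x f x^T and x g x^T.  Smoothness is the
    Jacobian criterion: at a point x of X the differentials x f and x g are
    linearly independent, i.e. no member a f + b g of the pencil has its vertex
    on X ([smooth_pencil_of_smooth]).

    No large quadrics ([quadric_notin_base_locus]).  Let L be the linear span
    of a quadric Q contained in X.  Both forms vanish on Q, hence are multiples
    on L of the equation of Q, hence some member G of the pencil vanishes on L.
    When Q has dimension n/2 + 1, rounded down, L is so large that it meets the
    kernel of G in a vector plane; a zero of another member in that plane is a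
    vertex of G lying on X.

    Existence of quadrics.  The pencil contains an invertible member
    ([pencil_member_unit]), and with respect to it the other members are
    diagonalizable with distinct eigenvalues ([smooth_pencil_diag]), so one may
    assume that g is the dot product and f is diag(l) with distinct l_i.  Let E
    be a vector plane on which a member G vanishes and the dot product is
    nondegenerate, and suppose that some y, orthogonal to E for all members of
    the pencil, satisfies G(y) = 0 and y.y <> 0.  Then E + y extends to a
    G-isotropic subspace L of vector dimension m + 2 ([span_of_third]).  On L
    the whole pencil reduces to the multiples of the dot product, which has
    rank at least 3 there, so that L cuts X in an irreducible quadric of
    dimension m.

    Let U be the common orthogonal of E.  If there is no such y, then by
    [exists_third] either some nonzero y of U satisfies y G = e G with e in E,
    or for some constant c every y of U satisfies y (1 - c G) = e G with e in E.
    In diagonal coordinates these equations are explicit.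
    - For n = 2m, let E join x to the vertex e_0 of the singular member
      f - l_0 g: it vanishes at x and at its vertex, hence on E.  Neither
      case occurs if all the coordinates of x are nonzero
      ([span_through_vertex]).
    - For two points p and x of X, let E join p to x and let G be the member
      (p.x) f - f(p, x) g, which vanishes on E.  For general x the
      first case does not occur, and the second one only if 1 - c G is
      proportional to g, or to f - mu g with sum_i p_i^2 / (l_i - mu) = 0.
      There are finitely many such mu, they depend on p alone, and each
      possibility is excluded by the nonvanishing at x of one quadratic form
      ([span_through_two_points]).

    All genericity conditions on x have the form h(x) <> 0 for finitely many
    quadratic forms h.  Since X is irreducible it suffices that each of them be
    nonzero somewhere on X ([general_of_forms]).  This holds because the
    diagonal equations are invariant under changes of sign of the coordinates:
    from one point without zero coordinates, the sign changes reach points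
    where a given linear form, or a given form with a nonzero off-diagonal
    coefficient, does not vanish ([linear_nonzero], [offdiag_nonzero]). *)

Set Implicit Arguments.
Unset Strict Implicit.
Unset Printing Implicit Defensive.

Import GRing.Theory Num.Theory.
Local Open Scope classical_set_scope.
Local Open Scope ring_scope.

(** * Bilinear forms and subspaces *)

Section BilinearForms.
Variables (K : numClosedFieldType) (d : nat).
Implicit Types (f g : 'M[K]_d) (x y z : 'rV[K]_d).

Definition bf g x y : K := (x *m g *m y^T) 0 0.

Lemma bfDl g x y z : bf g (x + y) z = bf g x z + bf g y z.
Proof. by rewrite /bf !mulmxDl mxE. Qed.

Lemma bfDr g x y z : bf g x (y + z) = bf g x y + bf g x z.
Proof. by rewrite /bf linearD /= mulmxDr mxE. Qed.

Lemma bfZl g a x y : bf g (a *: x) y = a * bf g x y.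
Proof. by rewrite /bf -!scalemxAl mxE. Qed.

Lemma bfZr g a x y : bf g x (a *: y) = a * bf g x y.
Proof. by rewrite /bf linearZ /= -scalemxAr mxE. Qed.

Lemma bfDm f g x y : bf (f + g) x y = bf f x y + bf g x y.
Proof. by rewrite /bf mulmxDr mulmxDl mxE. Qed.

Lemma bfZm a g x y : bf (a *: g) x y = a * bf g x y.
Proof. by rewrite /bf -scalemxAr -scalemxAl mxE. Qed.

Lemma bf0l g x : bf g 0 x = 0.
Proof. by rewrite /bf !mul0mx mxE. Qed.

Lemma bfC g x y : g^T = g -> bf g x y = bf g y x.
Proof.
move=> gT; have -> : bf g x y = (x *m g *m y^T)^T 0 0 by rewrite mxE.
by rewrite !trmx_mul trmxK gT mulmxA.
Qed.

Lemma bf_mulmx g x y : bf g x y = bf 1%:M (x *m g) y.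
Proof. by rewrite /bf mulmx1. Qed.

Lemma bf_gram_eq0 k l g (A : 'M_(k, d)) (B : 'M_(l, d)) :
  (forall x y, (x <= A)%MS -> (y <= B)%MS -> bf g x y = 0) ->
  A *m g *m B^T = 0.
Proof.
move=> h; apply/matrixP => i j; rewrite [RHS]mxE.
have := h _ _ (row_sub i A) (row_sub j B); rewrite /bf => <-.
by rewrite -row_mul tr_row -row_mul !mxE; apply: eq_bigr => t _; rewrite !mxE.
Qed.

Lemma gram_eq0_bf k l g (A : 'M_(k, d)) (B : 'M_(l, d)) x y :
  A *m g *m B^T = 0 -> (x <= A)%MS -> (y <= B)%MS -> bf g x y = 0.
Proof.
move=> AB0 /submxP[u ->] /submxP[v ->].
have e : u *m A *m g *m (v *m B)^T = u *m (A *m g *m B^T) *m v^T.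
  by rewrite trmx_mul !mulmxA.
by rewrite /bf e AB0 mulmx0 mul0mx mxE.
Qed.

End BilinearForms.

Section Vectors.
Variables (K : numClosedFieldType) (d : nat).
Implicit Types (f g : 'M[K]_d) (x y z : 'rV[K]_d).

Lemma nonroot_exists (p : {poly K}) : p != 0 -> exists t, p.[t] != 0.
Proof.
move=> p0; apply: contrapT => h.
pose rs := [seq i%:R : K | i <- iota 0 (size p)].
have rs_uniq : uniq rs.
  by rewrite map_inj_uniq ?iota_uniq // => i j /eqP; rewrite eqr_nat => /eqP.
have rs_root : all (root p) rs.
  by apply/allP => t _; apply: contrapT => /negP pt; apply: h; exists t.
have := max_poly_roots p0 rs_root rs_uniq.
by rewrite size_map size_iota ltnn.
Qed.

Lemma exists_submx_notin k l (E : 'M[K]_(k, d)) (W : 'M[K]_(l, d)) :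
  (\rank E < \rank W)%N -> exists2 v : 'rV_d, (v <= W)%MS & ~~ (v <= E)%MS.
Proof.
move=> EW; have /row_subPn[i hi] : ~~ (W <= E)%MS.
  by apply: contraTN EW => /mxrankS; rewrite -leqNgt.
by exists (row i W); rewrite ?row_sub.
Qed.

Lemma exists_submx_ker k j (W : 'M[K]_(k, d)) (C : 'M[K]_(d, j)) :
  (j < \rank W)%N ->
  exists v : 'rV_d, [/\ (v <= W)%MS, v != 0 & v *m C = 0].
Proof.
move=> jW; have h := mxrank_mul_ker W C.
have : (0 < \rank (W :&: kermx C)%MS)%N.
  by rewrite -(ltn_add2l (\rank (W *m C))) h addn0 (leq_ltn_trans (rank_leq_col _)).
rewrite lt0n mxrank_eq0 -nz_row_eq0 => v0.
have := nz_row_sub (W :&: kermx C)%MS; rewrite sub_capmx => /andP[vW /sub_kermxP vC].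
by exists (nz_row (W :&: kermx C)%MS).
Qed.

(** For independent v and w in W, either w is isotropic or v + t w is isotropic
    for some t, a root of a polynomial of degree 2. *)
Lemma isotropic_exists g k (W : 'M[K]_(k, d)) :
  (2 <= \rank W)%N ->
  exists v : 'rV_d, [/\ (v <= W)%MS, v != 0 & bf g v v = 0].
Proof.
move=> W2; have [v [vW v0 _]] := exists_submx_ker (0 : 'M_(d, 0)) (ltnW W2).
have [|w wW wv] := @exists_submx_notin _ _ v W.
  by rewrite (leq_ltn_trans _ W2) // rank_leq_row.
have [ww|ww] := eqVneq (bf g w w) 0.
  by exists w; split => //; apply: contraNneq wv => ->; rewrite sub0mx.
pose p := \poly_(i < 3) [:: bf g v v; bf g v w + bf g w v; bf g w w]`_i.
have [|t] := closed_rootP p _; first by rewrite size_poly_eq.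
rewrite /root horner_poly !big_ord_recr big_ord0 /= => /eqP pt.
exists (v + t *: w); split.
- by rewrite addmx_sub ?scalemx_sub.
- apply: contraNneq wv => e; have t0 : t != 0.
    by apply: contra_neq v0 => t0; rewrite t0 scale0r addr0 in e.
  move/eqP: e; rewrite addrC addr_eq0 => /eqP/(congr1 (fun x => t^-1 *: x)).
  by rewrite scalerA mulVf // scale1r => ->; rewrite scalemx_sub // -scaleN1r scalemx_sub.
- by rewrite !(bfDl, bfDr, bfZl, bfZr) -[RHS]pt; ring.
Qed.

End Vectors.

(** * Quadratic forms restricted to a subspace *)

Section QuadraticForms.
Variables (K : numClosedFieldType) (d : nat).
Implicit Types (f g : 'M[K]_d) (x y z : 'rV[K]_d).

Lemma two_neq0 : 2 != 0 :> K.
Proof. by rewrite pnatr_eq0. Qed.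

(** On a line joining a non-zero of [f] to a non-zero of [g], the two forms
    become nonzero polynomials in one variable. *)
Lemma quadratic_forms_domain k (W : 'M[K]_(k, d)) (f g : 'M[K]_d) :
  (forall y, (y <= W)%MS -> bf f y y * bf g y y = 0) ->
  (forall y, (y <= W)%MS -> bf f y y = 0) \/
  (forall y, (y <= W)%MS -> bf g y y = 0).
Proof.
move=> h; apply: contrapT => /not_orP[/existsNP[v /not_implyP[vW /eqP fv]]].
move=> /existsNP[w /not_implyP[wW /eqP gw]].
pose p (m : 'M[K]_d) := \poly_(i < 3) [:: bf m v v; bf m v w + bf m w v; bf m w w]`_i.
have pE m t : (p m).[t] = bf m (v + t *: w) (v + t *: w).
  rewrite horner_poly !big_ord_recr big_ord0 /= !(bfDl, bfDr, bfZl, bfZr); ring.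
have pf : p f != 0.
  by apply: contraNneq fv => /(congr1 (fun q : {poly K} => q`_0)); rewrite coef_poly coef0 /= => ->.
have pg : p g != 0.
  by apply: contraNneq gw => /(congr1 (fun q : {poly K} => q`_2)); rewrite coef_poly coef0 /= => ->.
have [t] := nonroot_exists (mulf_neq0 pf pg).
by rewrite hornerM !pE h ?eqxx // addmx_sub ?scalemx_sub.
Qed.

(** Choose v with g(v) <> 0 and c such that F = f - c g vanishes at v.  If the
    plane spanned by v and y meets g = 0 in two distinct lines, then F vanishes
    on three lines of that plane, hence on the plane.  So F times the
    discriminant of g on this plane, a quadratic form D in y, is zero; either F
    or D vanishes, and D = 0 says that g is a multiple of a square. *)
Lemma form_vanish k (W : 'M[K]_(k, d)) f g :
  f^T = f -> g^T = g ->
  (forall y, (y <= W)%MS -> bf g y y = 0 -> bf f y y = 0) ->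
  (exists c, forall y, (y <= W)%MS -> bf f y y = c * bf g y y) \/
  (exists v, [/\ (v <= W)%MS, bf g v v != 0 &
     forall y, (y <= W)%MS -> bf g v v * bf g y y = bf g v y ^+ 2]).
Proof.
move=> fT gT fg0.
have [g0|/existsNP[v /not_implyP[vW /eqP gv]]] :=
  pselect (forall y, (y <= W)%MS -> bf g y y = 0).
  by left; exists 0 => y yW; rewrite mul0r fg0 ?g0.
pose c := bf f v v / bf g v v.
pose F := f - c *: g.
pose D := (g *m v^T) *m (v *m g) - bf g v v *: g.
have FE x y : bf F x y = bf f x y - c * bf g x y by rewrite bfDm -scaleNr bfZm mulNr.
have DE y : bf D y y = bf g v y ^+ 2 - bf g v v * bf g y y.
  rewrite bfDm -scaleNr bfZm mulNr; congr (_ - _).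
  rewrite expr2 {1}(bfC _ _ gT) /bf !mulmxA -mulmxA -(mulmxA (y *m g *m v^T)).
  by rewrite mxE big_ord1 !mulmxA.
have FD y : (y <= W)%MS -> bf F y y * bf D y y = 0.
  move=> yW; have [->|D0] := eqVneq (bf D y y) 0; first by rewrite mulr0.
  suff -> : bf F y y = 0 by rewrite mul0r.
  have Fv : bf F v v = 0 by rewrite FE /c divfK ?subrr.
  (* the zeros s v + y of g on the plane are zeros of f, hence of F *)
  have Froot s : bf g v v * s ^+ 2 + 2 * bf g v y * s + bf g y y = 0 ->
      bf F y y + 2 * s * bf F v y = 0.
    move=> gs; have yE : bf F (s *: v + y) (s *: v + y) = 0.
      have ygs : bf g (s *: v + y) (s *: v + y) = 0.
        by rewrite -[RHS]gs !(bfDl, bfDr, bfZl, bfZr) (bfC y v gT); ring.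
      by rewrite FE ygs mulr0 subr0 fg0 // addmx_sub ?scalemx_sub.
    have FT : F^T = F by rewrite /F linearB linearZ /= fT gT.
    by rewrite -[RHS]yE !(bfDl, bfDr, bfZl, bfZr) (bfC y v FT) Fv; ring.
  pose r := sqrtC (bf D y y).
  have r2 : r ^+ 2 = bf g v y ^+ 2 - bf g v v * bf g y y by rewrite sqrtCK DE.
  have e1 : bf F y y + 2 * ((- bf g v y + r) / bf g v v) * bf F v y = 0.
    apply: Froot; apply: (mulfI gv); rewrite mulr0.
    transitivity (r ^+ 2 - (bf g v y ^+ 2 - bf g v v * bf g y y)); first by field.
    by rewrite r2 subrr.
  have e2 : bf F y y + 2 * ((- bf g v y - r) / bf g v v) * bf F v y = 0.
    apply: Froot; apply: (mulfI gv); rewrite mulr0.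
    transitivity (r ^+ 2 - (bf g v y ^+ 2 - bf g v v * bf g y y)); first by field.
    by rewrite r2 subrr.
  have : 4 * r / bf g v v * bf F v y = 0.
    by rewrite -[RHS](subrr 0) -{1}e1 -e2; field.
  move/eqP; rewrite !mulf_eq0 invr_eq0 (negPf gv) sqrtC_eq0 (negPf D0) pnatr_eq0 /=.
  by move=> /eqP F0; move: e1; rewrite F0 mulr0 addr0.
case: (quadratic_forms_domain FD) => [F0|D0]; [left|right].
  by exists c => y yW; apply/eqP; rewrite -subr_eq0 -FE F0.
by exists v; split=> // y yW; apply/eqP; rewrite eq_sym -subr_eq0 -DE D0.
Qed.

Lemma bf_polar k (W : 'M[K]_(k, d)) g :
  g^T = g -> (forall y, (y <= W)%MS -> bf g y y = 0) ->
  forall x y, (x <= W)%MS -> (y <= W)%MS -> bf g x y = 0.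
Proof.
move=> gT g0 x y xW yW; apply: (mulfI two_neq0); rewrite mulr0.
have := g0 (x + y) (addmx_sub xW yW).
by rewrite !(bfDl, bfDr) (bfC y x gT) !g0 // add0r addr0 => <-; ring.
Qed.

(** The alternative left open by [form_vanish] is that g is the square of a
    linear form on W; its zeros would then be orthogonal to W. *)
Lemma isotropic_separates k (W : 'M[K]_(k, d)) f g :
  f^T = f -> g^T = g -> (2 <= \rank W)%N ->
  (forall y, (y <= W)%MS -> (forall z, (z <= W)%MS -> bf g y z = 0) -> y = 0) ->
  (forall c, ~ forall y, (y <= W)%MS -> bf f y y = c * bf g y y) ->
  exists y, [/\ (y <= W)%MS, bf g y y = 0 & bf f y y != 0].
Proof.
move=> fT gT W2 gnd fNg; apply: contrapT => h.
case: (@form_vanish k W f g fT gT) => [y yW gy||[v [vW gv gW]]].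
- by apply: contrapT => /eqP fy; apply: h; exists y.
- by case=> c; apply: fNg.
have [y [yW y0 vy]] := exists_submx_ker (g *m v^T) W2.
have gvy : bf g v y = 0 by rewrite bfC // /bf -mulmxA vy mxE.
have gy : bf g y y = 0.
  by apply: (mulfI gv); rewrite gW // gvy expr0n mulr0.
move/eqP: y0; apply; apply: gnd => // z zW.
apply: (mulfI two_neq0); apply: (mulfI gv); rewrite !mulr0.
have gvyz : bf g v (y + z) = bf g v z by rewrite bfDr gvy add0r.
have := gW (y + z) (addmx_sub yW zW).
rewrite gvyz -gW // !(bfDl, bfDr) gy (bfC z y gT) => e.
by apply: (addIr (bf g v v * bf g z z)); rewrite add0r -[RHS]e; ring.
Qed.

(** The orthogonal of W has dimension d - rank (W g), so as long as it exceeds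
    W by two dimensions it contains an isotropic vector outside W.  The
    kernel of g meets W in dimension at least [c], which leaves more room: W can
    grow to dimension (d + c) / 2. *)
Lemma isotropic_extend g (W : 'M[K]_d) c t :
  g^T = g -> W *m g *m W^T = 0 ->
  (\rank (W *m g) + c <= \rank W)%N -> (\rank W <= t)%N ->
  (t.*2 <= d + c)%N ->
  exists L : 'M[K]_d, [/\ L *m g *m L^T = 0, (W <= L)%MS & \rank L = t].
Proof.
move=> gT; have [k] := ubnP (t - \rank W)%N.
elim: k W => // k IH W kW W0 cW Wt td.
have [Wt'|tW] := ltnP (\rank W) t; last first.
  by exists W; split=> //; apply/eqP; rewrite eqn_leq Wt.
(* the orthogonal of W *)
pose V := kermx (g *m W^T).
have WV : (W <= V)%MS by apply/sub_kermxP; rewrite mulmxA.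
have rV : (\rank V = d - \rank (W *m g))%N.
  by rewrite mxrank_ker -mxrank_tr trmx_mul trmxK gT.
have rd := rank_leq_row W.
have V2 : (2 <= \rank (V :\: W)%MS)%N.
  have := mxrank_cap_compl V W; rewrite (capmx_idPr WV) rV => e.
  move: td kW cW Wt' e rd; rewrite -addnn; move: (\rank _) (\rank _) (\rank _).
  by clear; lia.
have [v [vVW v0 gv]] := isotropic_exists g V2.
have vV : (v <= V)%MS by rewrite (submx_trans vVW) // diffmxSl.
have vW : (W :&: v)%MS = 0.
  apply/eqP; rewrite -submx0 -(capmx_diff V W).
  by rewrite [(W :&: _)%MS]capmxC capmxS.
have rWv : (\rank (W + v)%MS = (\rank W).+1)%N.
  by rewrite mxrank_disjoint_sum // rank_rV v0 addn1.
have Wgv : W *m g *m v^T = 0.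
  have /sub_kermxP : (v <= V)%MS by [].
  by rewrite mulmxA => /(congr1 trmx); rewrite !trmx_mul trmxK gT trmx0 mulmxA.
have iso : (W + v)%MS *m g *m (W + v)%MS^T = 0.
  apply: bf_gram_eq0 => x y /sub_addsmxP[[a1 a2] /= ->] /sub_addsmxP[[b1 b2] /= ->].
  have sv (a : 'M[K]_1) : (a *m v <= v)%MS by rewrite submxMl.
  have sW (a : 'M[K]_(1, d)) : (a *m W <= W)%MS by rewrite submxMl.
  rewrite !(bfDl, bfDr) (gram_eq0_bf W0 (sW _) (sW _)) (gram_eq0_bf Wgv (sW _) (sv _)).
  rewrite (bfC _ _ gT) (gram_eq0_bf Wgv (sW _) (sv _)) !add0r.
  apply: (gram_eq0_bf _ (sv a2) (sv b2)).
  by apply/matrixP => i j; rewrite !ord1 [RHS]mxE.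
have rWvg : (\rank ((W + v)%MS *m g) <= (\rank (W *m g)).+1)%N.
  rewrite (eqmxMr g (addsmxE W v)) mul_col_mx -addsmxE.
  apply: (leq_trans (mxrank_adds_leqif _ _)); rewrite addnC.
  exact: (leq_add (rank_leq_row (v *m g)) (leqnn _)).
have [||||L [L0 WL rL]] := IH (W + v)%MS _ iso; rewrite ?rWv //.
- by rewrite ltnS in kW; apply: leq_trans kW; rewrite ltn_sub2l.
- by rewrite (leq_trans (leq_add rWvg (leqnn c))) // addSn ltnS.
- by exists L; split=> //; rewrite (submx_trans _ WL) // addsmxSl.
Qed.

End QuadraticForms.

(** * Quadratic polynomials and irreducibility *)

Section QuadraticPolynomials.
Variables (K : numClosedFieldType) (d : nat).
Implicit Types (f g : 'M[K]_d) (x y z : 'rV[K]_d).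

Lemma sym_bf_inj f g :
  f^T = f -> g^T = g -> (forall y, bf f y y = bf g y y) -> f = g.
Proof.
move=> fT gT fg; apply/eqP; rewrite -subr_eq0; apply/eqP.
have h0 y : (y <= (1%:M : 'M[K]_d))%MS -> bf (f - g) y y = 0.
  by move=> _; rewrite bfDm -scaleN1r bfZm fg mulN1r subrr.
have hT : (f - g)^T = f - g by rewrite linearB /= fT gT.
have h : 1%:M *m (f - g) *m (1%:M : 'M[K]_d)^T = 0.
  by apply: bf_gram_eq0; apply: bf_polar.
by rewrite mul1mx trmx1 mulmx1 in h.
Qed.

(** The Gram matrix of E and y is block diagonal. *)
Lemma gram_rank_ge3 t (h : 'M[K]_d) (E : 'M[K]_(2, d)) y (L : 'M[K]_(t, d)) :
  h^T = h -> E *m h *m E^T \in unitmx -> E *m h *m y^T = 0 ->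
  bf h y y != 0 -> (E <= L)%MS -> (y <= L)%MS ->
  (3 <= \rank (L *m h *m L^T))%N.
Proof.
move=> hT EE Ey yy EL yL.
have /submxP[B eB] : (col_mx E y <= L)%MS by rewrite col_mx_sub EL.
have yE : y *m h *m E^T = 0.
  by apply: trmx_inj; rewrite !trmx_mul trmxK hT trmx0 mulmxA.
have u : col_mx E y *m h *m (col_mx E y)^T \in unitmx.
  rewrite mul_col_mx tr_col_mx mul_col_row Ey yE block_diag_mx_unit EE /=.
  rewrite [X in X \in _]mx11_scalar unitmxE det_scalar1 unitfE; exact: yy.
rewrite -[X in (X <= _)%N](mxrank_unit u) eB trmx_mul.
have -> : B *m L *m h *m (L^T *m B^T) = B *m (L *m h *m L^T) *m B^T.
  by rewrite !mulmxA.
by rewrite (leq_trans (mxrankM_maxl _ _)) // mxrankM_maxr.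
Qed.

Definition quadpoly g : {mpoly K[d]} := \sum_i \sum_j g i j *: ('X_i * 'X_j).

Definition linpoly (a : 'cV[K]_d) : {mpoly K[d]} := \sum_i a i 0 *: 'X_i.

Lemma meval_linpoly a x : (linpoly a).@[fun i => x 0 i] = (x *m a) 0 0.
Proof.
rewrite /linpoly raddf_sum mxE; apply: eq_bigr => i _ /=.
by rewrite mevalZ mevalXU mulrC.
Qed.

Lemma quadpoly_mul (a b : 'cV[K]_d) : quadpoly (a *m b^T) = linpoly a * linpoly b.
Proof.
rewrite /quadpoly /linpoly mulr_suml; apply: eq_bigr => i _.
rewrite mulr_sumr; apply: eq_bigr => j _.
by rewrite mxE big_ord1 mxE -scalerAl -scalerAr scalerA.
Qed.

Lemma quadpolyD f g : quadpoly (f + g) = quadpoly f + quadpoly g.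
Proof.
rewrite /quadpoly -big_split; apply: eq_bigr => i _ /=.
by rewrite -big_split; apply: eq_bigr => j _ /=; rewrite mxE scalerDl.
Qed.

Lemma quadpolyZ a g : quadpoly (a *: g) = a *: quadpoly g.
Proof.
rewrite /quadpoly scaler_sumr; apply: eq_bigr => i _.
by rewrite scaler_sumr; apply: eq_bigr => j _; rewrite mxE scalerA.
Qed.

Lemma quadpoly_tr g : quadpoly g^T = quadpoly g.
Proof.
rewrite /quadpoly exchange_big; apply: eq_bigr => i _; apply: eq_bigr => j _.
by rewrite mxE mulrC.
Qed.

Lemma meval_quadpoly g x : (quadpoly g).@[fun i => x 0 i] = bf g x x.
Proof.
rewrite /quadpoly raddf_sum /= /bf -mulmxA mxE; apply: eq_bigr => i _ /=.
rewrite raddf_sum mxE mulr_sumr; apply: eq_bigr => j _ /=.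
by rewrite mevalZ mevalM !mevalXU mxE mulrCA.
Qed.

Lemma linpoly_homog a : linpoly a \is 1.-homog.
Proof.
apply: rpred_sum => i _; apply: dhomogZ.
by rewrite dhomogX /= mdeg1.
Qed.

Lemma quadpoly_homog g : quadpoly g \is 2.-homog.
Proof.
apply: rpred_sum => i _; apply: rpred_sum => j _; apply: dhomogZ.
by rewrite -mpolyXD dhomogX /= mdegD !mdeg1.
Qed.

Lemma mdeg2_split (m : 'X_{1..d}) : mdeg m = 2%N ->
  exists i j, m = (U_(i) + U_(j))%MM.
Proof.
move=> m2; have [i mi] : exists i, m i != 0%N.
  apply: contrapT => h; have m0 : m = 0%MM.
    by apply/mnmP => i; rewrite mnmE; apply: contrapT => /eqP mi; apply: h; exists i.
  by rewrite m0 mdeg0 in m2.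
have mE : (m - U_(i) + U_(i))%MM = m by apply: submK; rewrite lep1mP.
have : mdeg (m - U_(i))%MM == 1%N by rewrite -eqSS -m2 -{2}mE mdegD mdeg1 addn1.
by rewrite mdeg_eq1 => /existsP[j /eqP e]; exists j, i; rewrite -e.
Qed.

Lemma homog2_quadpoly (p : {mpoly K[d]}) :
  p \is 2.-homog -> exists2 g, g^T = g & p = quadpoly g.
Proof.
move=> /dhomogP hp; have [g ->] : exists g, p = quadpoly g.
  rewrite [p]mpolyE big_seq.
  elim/big_rec: _ => [|m q mp [g ->]].
    by exists 0; rewrite /quadpoly big1 // => i _; rewrite big1 // => j _; rewrite mxE scale0r.
  have /mdeg2_split[i [j ->]] := hp m mp.
  exists (p@_(U_(i) + U_(j)) *: delta_mx i j + g).
  rewrite quadpolyD quadpolyZ mpolyXD; congr (_ *: _ + _).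
  rewrite /quadpoly (bigD1 i) //= (bigD1 j) //= mxE !eqxx scale1r.
  rewrite !big1 ?addr0 // => [k ki|k kj].
    by rewrite big1 // => l _; rewrite mxE (negPf ki) scale0r.
  by rewrite mxE (negPf kj) andbF scale0r.
exists (2^-1 *: (g + g^T)).
  by rewrite linearZ /= linearD /= trmxK addrC.
by rewrite quadpolyZ quadpolyD quadpoly_tr -mulr2n -scaler_nat scalerA mulVf ?scale1r ?two_neq0.
Qed.

Lemma quadpoly_eq0 g : g^T = g -> quadpoly g = 0 -> g = 0.
Proof.
move=> gT g0; apply: sym_bf_inj => // [|y]; first by rewrite trmx0.
by rewrite -meval_quadpoly g0 meval0 /bf mulmx0 mul0mx mxE.
Qed.

Lemma homog_unit k (p : {mpoly K[d]}) :
  p \is k.+1.-homog -> p \isn't a GRing.unit.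
Proof.
move=> pk; apply/negP => pu; have p0 : p != 0.
  by apply: contraTneq pu => ->; rewrite unitr0.
have : p \is 0.-homog.
  have /andP[/eqP -> _] : p \in @mpoly_unit d K by [].
  by rewrite -[_%:MP]mulr1 mul_mpolyC dhomogZ // dhomog1.
by move=> /(dhomog_uniq p0 pk).
Qed.

Lemma msize2_meval (p : {mpoly K[d]}) x : (msize p <= 2)%N ->
  p.@[fun i => x 0 i] = p@_0 + (x *m \col_i p@_U_(i)) 0 0.
Proof.
move=> p2; rewrite -meval_linpoly -[p@_0 in RHS](mevalC (fun i => x 0 i)) -mevalD.
congr (_.@[_]); apply/mpolyP => m; rewrite mcoeffD mcoeffC raddf_sum /=.
under eq_bigr => i _ do rewrite mcoeffZ mxE mcoeffX.
have [m2|m2] := leqP 2 (mdeg m).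
  rewrite memN_msupp_eq0 ?msize_mdeg_ge ?(leq_trans p2) //.
  rewrite big1 ?addr0 => [|i _]; last first.
    by case: eqP => [e|_]; rewrite ?mulr0 //; rewrite -e mdeg1 in m2.
  by case: eqP => [e|_]; rewrite ?mulr0 //; rewrite e mdeg0 in m2.
have [/eqP|m0] := eqVneq (mdeg m) 0%N.
  rewrite mdeg_eq0 => /eqP ->; rewrite eqxx mulr1 big1 ?addr0 // => i _.
  by case: eqP => [/(congr1 mdeg)|]; rewrite ?mulr0 // mdeg1 mdeg0.
have /mdeg1P[i /eqP ->] : mdeg m == 1%N by case: (mdeg m) m2 m0 => [|[]].
rewrite (bigD1 i) //= eqxx mulr1 big1 => [|j ji]; last first.
  case: eqP => [/(congr1 (fun m : 'X_{1..d} => m j))|]; rewrite ?mulr0 //.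
  by rewrite !mnm1E eqxx eq_sym (negPf ji).
by rewrite addr0; case: eqP => [/(congr1 mdeg)|]; rewrite ?mulr0 ?add0r // mdeg1 mdeg0.
Qed.

(** The leading parts of two affine factors would be linear forms with product
    g, and the symmetrized product of two linear forms has rank at most 2. *)
Lemma quadpoly_irreducible g :
  g^T = g -> (3 <= \rank g)%N -> irreducible_mpoly (quadpoly g).
Proof.
move=> gT g3; split; first exact: homog_unit (quadpoly_homog g).
move=> a b gab; have p0 : quadpoly g != 0.
  by apply: contraTneq g3 => /(quadpoly_eq0 gT) ->; rewrite mxrank0.
have [a0 b0] : a != 0 /\ b != 0.
  by split; apply: contraNneq p0 => e; rewrite gab e ?mul0r ?mulr0.
have sz : (msize a + msize b = 4)%N.
  have : msize (quadpoly g) = 3%N.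
    rewrite -(mlead_deg p0); congr _.+1.
    exact: (dhomog_mf (quadpoly_homog g) (mlead_supp p0)).
  by rewrite gab msizeM // -!(mlead_deg a0) -!(mlead_deg b0) addSn => /= ->.
have un (c : {mpoly K[d]}) : c != 0 -> (msize c <= 1)%N -> c \is a GRing.unit.
  move=> c0 /msize1_polyC cE; rewrite cE in c0 *; apply: rmorph_unit.
  by rewrite unitfE; apply: contraNneq c0 => ->; rewrite mpolyC0.
have [a1|a2] := leqP (msize a) 1; first by left; apply: un.
have [b1|b2] := leqP (msize b) 1; first by right; apply: un.
exfalso; have sa : (msize a <= 2)%N by lia.
have sb : (msize b <= 2)%N by lia.
pose u : 'cV[K]_d := \col_i a@_U_(i); pose v : 'cV[K]_d := \col_i b@_U_(i).
have gE y : bf g y y = (a@_0 + (y *m u) 0 0) * (b@_0 + (y *m v) 0 0).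
  by rewrite -!msize2_meval // -mevalM -gab meval_quadpoly.
have oppmxE (z : 'M[K]_1) : (- z) 0 0 = - z 0 0 by rewrite mxE.
have gE' y : bf g y y = (y *m u) 0 0 * (y *m v) 0 0.
  have ab0 : a@_0 * b@_0 = 0.
    by have := gE 0; rewrite bf0l !mul0mx !mxE !addr0 => /esym.
  (* evaluating at y and -y separates the even part of the product *)
  have gN : bf g y y = (a@_0 - (y *m u) 0 0) * (b@_0 - (y *m v) 0 0).
    have := gE (- y); rewrite !mulNmx !oppmxE => <-.
    by rewrite -scaleN1r bfZl bfZr; ring.
  apply: (mulfI (two_neq0 K)).
  transitivity (bf g y y + bf g y y); first by ring.
  rewrite {1}gE gN.
  ring: ab0.
have gN : g = 2^-1 *: (u *m v^T + v *m u^T).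
  apply: sym_bf_inj => // [|y].
    by rewrite linearZ linearD /= !trmx_mul !trmxK addrC.
  rewrite gE' bfZm bfDm /bf.
  have bfM (a1 b1 : 'cV[K]_d) :
      (y *m (a1 *m b1^T) *m y^T) 0 0 = (y *m a1) 0 0 * (y *m b1) 0 0.
    rewrite mulmxA -mulmxA mxE big_ord1; congr (_ * _).
    by rewrite -trmx_mul mxE.
  by rewrite !bfM; field.
have : (\rank g <= 2)%N.
  rewrite gN (leq_trans (mxrank_scale _ _)) // (leq_trans (mxrank_add _ _)) //.
  by apply: (@leq_add _ _ 1 1); rewrite (leq_trans (mxrankM_maxl _ _)) // rank_leq_col.
by rewrite leqNgt g3.
Qed.

Lemma irreducible_not_square g (a : 'cV[K]_d) c :
  irreducible_mpoly (quadpoly g) -> g <> c *: (a *m a^T).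
Proof.
move=> [_ irr] gE; have := irr (c *: linpoly a) (linpoly a).
rewrite gE quadpolyZ quadpoly_mul scalerAl => /(_ erefl).
have lu k : k *: linpoly a \isn't a GRing.unit.
  by apply: (@homog_unit 0); rewrite dhomogZ // linpoly_homog.
by case; apply/negP; rewrite ?lu // -[linpoly a]scale1r lu.
Qed.

End QuadraticPolynomials.

(** * Tangent spaces of the base locus of a pencil *)

Section DirectionalDerivative.
Variables (K : numClosedFieldType) (d : nat).
Implicit Types (p q : {mpoly K[d]}) (v w : 'rV[K]_d).

Definition dirder v w p : K := \sum_i p^`M(i).@[fun i => v 0 i] * w 0 i.

Lemma dirderD v w p q : dirder v w (p + q) = dirder v w p + dirder v w q.
Proof.
rewrite /dirder -big_split; apply: eq_bigr => i _ /=.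
by rewrite mderivD mevalD mulrDl.
Qed.

Lemma dirderZ v w a p : dirder v w (a *: p) = a * dirder v w p.
Proof.
rewrite /dirder mulr_sumr; apply: eq_bigr => i _ /=.
by rewrite mderivZ mevalZ mulrA.
Qed.

Lemma dirderM v w p q :
  dirder v w (p * q) =
  dirder v w p * q.@[fun i => v 0 i] + p.@[fun i => v 0 i] * dirder v w q.
Proof.
rewrite /dirder mulr_suml mulr_sumr -big_split; apply: eq_bigr => i _ /=.
by rewrite mderivM mevalD !mevalM; ring.
Qed.

(** The polar form is half the differential. *)
Lemma dirder_quadpoly v w g : g^T = g -> dirder v w (quadpoly g) = 2 * bf g v w.
Proof.
move=> gT; have dX k : dirder v w 'X_k = w 0 k.
  rewrite /dirder (bigD1 k) //= big1 => [|i ik]; last first.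
    by rewrite mderivX mnm1E eq_sym (negPf ik) scale0r meval0 mul0r.
  have -> : 'X_k^`M(k) = 1 :> {mpoly K[d]}.
    rewrite mderivX mnm1E eqxx scale1r -[RHS]mpolyX0; congr 'X_[_].
    by apply/mnmP => i; rewrite mnmBE subnn mnmE.
  by rewrite meval1 mul1r addr0.
have d0 : dirder v w 0 = 0 by rewrite -(scale0r 0) dirderZ mul0r.
have dsum (F : 'I_d -> {mpoly K[d]}) :
    dirder v w (\sum_i F i) = \sum_i dirder v w (F i).
  by apply: (big_morph _ _ d0) => p q; rewrite dirderD.
transitivity (bf g v w + bf g w v); last by rewrite (bfC w v gT); ring.
rewrite /quadpoly dsum /bf -!mulmxA !mxE -big_split; apply: eq_bigr => i _ /=.
rewrite dsum !mxE !mulr_sumr -big_split; apply: eq_bigr => j _ /=.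
by rewrite dirderZ dirderM !dX !mevalXU !mxE; ring.
Qed.

End DirectionalDerivative.

Section Loci.
Variables (K : numClosedFieldType) (N : nat).
Implicit Types (X : set (ppoint K N)) (f g h : 'M[K]_N.+1).

(** The Jacobian criterion: since 2 (x f) and 2 (x g) are the differentials at
    x, no member of the pencil has its vertex on the common zero locus. *)
Definition smooth_pencil f g := forall x : 'rV[K]_N.+1, x != 0 ->
  bf f x x = 0 -> bf g x x = 0 ->
  forall a b, a *: (x *m f) + b *: (x *m g) = 0 -> a = 0 /\ b = 0.

Definition base_locus f g : set (ppoint K N) :=
  [set x | bf f (val x) (val x) = 0 /\ bf g (val x) (val x) = 0].

Lemma peval_quadpoly g (x : ppoint K N) : peval (quadpoly g) x = bf g (val x) (val x).
Proof. exact: meval_quadpoly. Qed.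

Lemma monomial_neq0 (x : ppoint K N) k :
  exists2 m : 'X_{1..N.+1}, mdeg m = k & peval 'X_[m] x != 0.
Proof.
have /rV0Pn[i xi] := valP x.
exists (U_(i) *+ k)%MM; first by rewrite mdegMn mdeg1 mul1n.
by rewrite /peval -mpolyXn rmorphXn /= mevalXU expf_neq0.
Qed.

(** A homogeneous equation p of X satisfies 'X_[m] p = a F1 + b F2 for all
    monomials of some degree, and one of these is nonzero at a given point. *)
Lemma base_locus_eq X f g :
  zariski_closed X -> scheme_intersection X (quadpoly f) (quadpoly g) ->
  X = base_locus f g.
Proof.
move=> [S [_ XS]] sat; apply/seteqP; split => x.
  move=> Xx; split; rewrite -peval_quadpoly; apply: (sat _).2 => //; exists 0%N => m.
    by move/eqP; rewrite mdeg_eq0 => /eqP ->; exists 1, 0; rewrite mpolyX0 mul0r addr0.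
  by move/eqP; rewrite mdeg_eq0 => /eqP ->; exists 0, 1; rewrite mpolyX0 mul0r add0r.
move=> [fx gx]; apply/XS => p Sp.
have /(sat p).1[k hk] : vanishing_ideal X p by move=> y /XS; apply.
have [m mk mx] := monomial_neq0 x k.
have [a [b /(congr1 (meval (fun i => val x 0 i)))]] := hk m mk.
rewrite mevalD !mevalM !meval_quadpoly fx gx !mulr0 addr0.
by move/eqP; rewrite mulf_eq0 (negPf mx) => /eqP.
Qed.

Lemma has_dim_inj X a b : has_dim X a -> has_dim X b -> a = b.
Proof.
move=> [[c cX] ha] [[c' cX'] hb]; apply/eqP.
by rewrite eqn_leq (hb _ _ cX) (ha _ _ cX').
Qed.

End Loci.

(** Every element p of the ideal satisfies 'X_[m] p = a F1 + b F2 with 'X_[m]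
    nonzero at x, so by the Leibniz rule its differential at x is a combination
    of those of F1 and F2.  If these were dependent, the tangent space of the
    cone would contain a hyperplane, of dimension n + 2 instead of n + 1. *)
Lemma smooth_pencil_of_smooth (K : numClosedFieldType) n
    (X : set (ppoint K n.+2)) (f g : 'M[K]_n.+3) :
  f^T = f -> g^T = g -> X = base_locus f g -> has_dim X n ->
  scheme_intersection X (quadpoly f) (quadpoly g) -> smooth X -> smooth_pencil f g.
Proof.
move=> fT gT XE dimX sat [d' dimX' sm] v v0 fv gv a b ab0.
pose x : ppoint K n.+2 := exist _ v v0.
have Xx : X x by rewrite XE.
rewrite -(has_dim_inj dimX dimX') in sm.
have [T TE dT] := sm x Xx.
apply: contrapT => abN0.
(* u is the equation of that hyperplane *)
have [u hu] : exists u : 'cV[K]_n.+3, forall w : 'rV_n.+3, w *m u = 0 ->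
    bf f v w = 0 /\ bf g v w = 0.
  have bfE (h : 'M[K]_n.+3) w : w *m (v *m h)^T = 0 -> bf h v w = 0.
    move=> e; have : (w *m (v *m h)^T)^T = 0 by rewrite e trmx0.
    by rewrite trmx_mul trmxK /bf => ->; rewrite mxE.
  have abw w : a * bf f v w + b * bf g v w = 0.
    by have := bf0l 1%:M w; rewrite -ab0 bfDl !bfZl -!bf_mulmx.
  have [a0|a0] := eqVneq a 0; last first.
    exists (v *m g)^T => w /bfE gw; split=> //.
    by move: (abw w); rewrite gw mulr0 addr0 => /eqP; rewrite mulf_eq0 (negPf a0) => /eqP.
  have b0 : b != 0 by apply: contra_not_neq abN0 => b0.
  exists (v *m f)^T => w /bfE fw; split=> //.
  by move: (abw w); rewrite fw mulr0 add0r => /eqP; rewrite mulf_eq0 (negPf b0) => /eqP.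
pose L : 'Hom('rV[K]_n.+3, 'M[K]_1) := linfun (mulmxr u).
have LT : (lker L <= T)%VS.
  apply/subvP => w; rewrite memv_ker lfunE /= => /eqP /hu[fw gw].
  apply/TE => p Ip; have /sat[k hk] := Ip.
  have [m mk mx] := monomial_neq0 x k.
  have [c [e /(congr1 (dirder v w))]] := hk m mk.
  rewrite dirderD !dirderM !meval_quadpoly !dirder_quadpoly // fv gv fw gw !mulr0 !addr0.
  have -> : p.@[fun i => v 0 i] = 0 by exact: (Ip x Xx).
  by rewrite mulr0 add0r => /eqP; rewrite mulf_eq0 (negPf mx) => /eqP.
have := limg_ker_dim L fullv; rewrite capfv dimvf.
have := dimvS LT; rewrite dT.
have := dimvS (subvf (limg L)); rewrite dimvf.
have -> : dim 'M[K]_1 = 1%N by [].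
have -> : dim 'rV[K]_n.+3 = n.+3 by rewrite dim_matrix; exact: mul1n.

by move=> h1 h2 h3; lia.
Qed.

(** * Quadrics in the base locus, and general points *)

Section Congruence.
Variables (K : numClosedFieldType) (k d : nat).

Lemma bf_congr (g : 'M[K]_d) (A : 'M[K]_(k, d)) u v :
  bf (A *m g *m A^T) u v = bf g (u *m A) (v *m A).
Proof. by rewrite /bf trmx_mul !mulmxA. Qed.

Lemma congr_sym (g : 'M[K]_d) (A : 'M[K]_(k, d)) :
  g^T = g -> (A *m g *m A^T)^T = A *m g *m A^T.
Proof. by move=> gT; rewrite !trmx_mul trmxK gT mulmxA. Qed.

(** A Nullstellensatz in degree 2: irreducibility of the equation excludes the
    second alternative of [form_vanish]. *)
Lemma proportional_of_vanish (s h : 'M[K]_k) :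
  s^T = s -> h^T = h -> irreducible_mpoly (quadpoly s) ->
  (forall u, bf s u u = 0 -> bf h u u = 0) -> exists c, h = c *: s.
Proof.
move=> sT hT irr sh; have all1 (u : 'rV[K]_k) : (u <= (1%:M : 'M[K]_k))%MS by exact: submx1.
case: (@form_vanish _ _ _ (1%:M : 'M[K]_k) h s hT sT) => [u _|[c hc]|[v [_ sv sq]]].
- exact: sh.
- exists c; apply: sym_bf_inj => // [|u]; first by rewrite linearZ /= sT.
  by rewrite hc ?bfZm.
- exfalso; apply: (irreducible_not_square (a := s *m v^T) (c := (bf s v v)^-1) irr).
  apply: sym_bf_inj => // [|u]; first by rewrite linearZ /= trmx_mul trmxK.
  rewrite bfZm; apply: (mulfI sv); rewrite mulVKf // sq // expr2 {1}(bfC v u sT).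
  have sE : u *m (s *m v^T *m (s *m v^T)^T) *m u^T =
      (u *m s *m v^T) *m (v *m s *m u^T) by rewrite trmx_mul trmxK sT !mulmxA.
  by rewrite [in RHS]/bf sE [RHS]mxE big_ord1.
Qed.

End Congruence.

Section Subvarieties.
Variables (K : numClosedFieldType) (N : nat).
Implicit Types (X : set (ppoint K N)) (f g h : 'M[K]_N.+1).

(** On L both forms are multiples of g, so that L cuts the base locus in the
    single quadric g = 0, irreducible because of the rank. *)
Lemma quadric_in_base_locus m (f g : 'M[K]_N.+1) (L : 'M[K]_(m.+2, N.+1)) c :
  g^T = g -> row_free L -> (3 <= \rank (L *m g *m L^T))%N ->
  L *m f *m L^T = c *: (L *m g *m L^T) ->
  exists Q, [/\ quadric m Q, Q `<=` base_locus f g &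
    forall x, base_locus f g x -> (val x <= L)%MS -> Q x].
Proof.
move=> gT Lfree g3 fc; pose s := L *m g *m L^T.
exists [set x : ppoint K N | exists2 u : 'rV_m.+2, val x = u *m L &
   (quadpoly s).@[fun i => u 0 i] = 0]; split.
- exists L, (quadpoly s); split=> //; first exact: quadpoly_homog.
  by apply: quadpoly_irreducible => //; apply: congr_sym.
- move=> x [u xu]; rewrite meval_quadpoly => su; split; rewrite xu -bf_congr //.
  by rewrite fc bfZm su mulr0.
- move=> x [_ gx] /submxP[u xu]; exists u => //.
  by rewrite meval_quadpoly bf_congr -xu.
Qed.

Lemma forms_closed (hs : seq 'M[K]_N.+1) :
  zariski_closed [set x : ppoint K N | \prod_(h <- hs) bf h (val x) (val x) = 0].
Proof.
exists [set \prod_(h <- hs) quadpoly h]; split.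
  move=> p ->; elim: hs => [|h hs [e IH]].
    by exists 0%N; rewrite big_nil dhomog1.
  by exists (2 + e)%N; rewrite big_cons dhomogM // quadpoly_homog.
move=> x; have E : peval (\prod_(h <- hs) quadpoly h) x =
    \prod_(h <- hs) bf h (val x) (val x).
  rewrite /peval rmorph_prod; apply: eq_bigr => h _; exact: meval_quadpoly.
split=> [/= + p ->|/(_ _ erefl)]; by rewrite E.
Qed.

(** An irreducible set is not the union of finitely many closed proper
    subsets. *)
Lemma exists_common_nonzero X (hs : seq 'M[K]_N.+1) :
  variety X ->
  (forall h, h \in hs -> exists2 x, X x & bf h (val x) (val x) != 0) ->
  exists2 x, X x & forall h, h \in hs -> bf h (val x) (val x) != 0.
Proof.
move=> [_ [x0 X0] irr]; elim: hs => [|h hs IH] hne; first by exists x0.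
have [|x Xx hx] := IH; first by move=> h' h'hs; apply: hne; rewrite inE h'hs orbT.
apply: contrapT => none.
have [||||] := irr [set y | bf h (val y) (val y) = 0]
  [set y | \prod_(h <- hs) bf h (val y) (val y) = 0].
- by have := forms_closed [:: h]; congr zariski_closed; apply/seteqP; split=> y /=; rewrite big_seq1.
- exact: forms_closed.
- move=> y Xy; have [hy|hy] := eqVneq (bf h (val y) (val y)) 0; [by left|right].
  apply/eqP; rewrite prodf_seq_eq0; apply: contra_notT none => /hasPn ny.
  exists y => // h'; rewrite inE => /orP[/eqP -> //|h'hs].
  by have := ny _ h'hs.
- have [y Xy hy] := hne h (mem_head _ _).
  by move=> /(_ y Xy) /eqP; rewrite (negPf hy).
- move=> /(_ x Xx) /eqP; rewrite prodf_seq_eq0 => /hasP[h' h'hs /=].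
  by rewrite (negPf (hx _ h'hs)).
Qed.

Lemma general_of_forms X P (hs : seq 'M[K]_N.+1) :
  variety X ->
  (forall h, h \in hs -> exists2 x, X x & bf h (val x) (val x) != 0) ->
  (forall x, X x -> (forall h, h \in hs -> bf h (val x) (val x) != 0) -> P x) ->
  for_general_point X P.
Proof.
move=> Xvar hne hP; exists [set x | \prod_(h <- hs) bf h (val x) (val x) = 0].
split; first exact: forms_closed.
- have [x Xx hx] := exists_common_nonzero Xvar hne.
  move=> /(_ x Xx) /eqP; rewrite prodf_seq_eq0 => /hasP[h hhs /=].
  by rewrite (negPf (hx _ hhs)).
- move=> x Xx nz; apply: hP => // h hhs; apply: contra_notN nz => hx.
  by apply/eqP; rewrite prodf_seq_eq0; apply/hasP; exists h.
Qed.

End Subvarieties.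

(** With k = n/2 + 3 the vector dimension of the span of Q, an isotropic space
    of dimension k for G satisfies rank (A G) <= n + 3 - k, so it meets the
    kernel of G in dimension at least 2k - n - 3 >= 2. *)
Lemma quadric_notin_base_locus (K : numClosedFieldType) n (f g : 'M[K]_n.+3) Q :
  f^T = f -> g^T = g -> smooth_pencil f g ->
  quadric (n./2 + 1) Q -> ~ (Q `<=` base_locus f g).
Proof.
move=> fT gT sm [A [p [Afree /homog2_quadpoly[s sT ->] irr QE]]] QX.
have Avan u : bf s u u = 0 -> bf f (u *m A) (u *m A) = 0 /\ bf g (u *m A) (u *m A) = 0.
  move=> su; have [->|u0] := eqVneq u 0; first by rewrite mul0mx !bf0l.
  have uA : u *m A != 0 by rewrite mulmx_free_eq0.
  pose x : ppoint K n.+2 := exist (fun v => v != 0) _ uA.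
  have Qx : Q x by apply/QE; exists u; rewrite ?meval_quadpoly.
  exact: (QX _ Qx).
have [c1 fc] : exists c, A *m f *m A^T = c *: s.
  apply: proportional_of_vanish => //; first exact: congr_sym.
  by move=> u /Avan[+ _]; rewrite bf_congr.
have [c2 gc] : exists c, A *m g *m A^T = c *: s.
  apply: proportional_of_vanish => //; first exact: congr_sym.
  by move=> u /Avan[_ +]; rewrite bf_congr.
(* G = a f + b g vanishes on the span of Q, and h generates the pencil with G *)
have [a [b [h [ab0 AG Gh]]]] : exists a b h, [/\ ~ (a = 0 /\ b = 0),
    A *m (a *: f + b *: g) *m A^T = 0 &
    forall x, a * bf f x x + b * bf g x x = 0 -> bf h x x = 0 ->
      bf f x x = 0 /\ bf g x x = 0].
  have AE a b : A *m (a *: f + b *: g) *m A^T = (a * c1 + b * c2) *: s.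
    by rewrite mulmxDr mulmxDl -!scalemxAr -!scalemxAl fc gc !scalerA scalerDl.
  have [c10|c10] := eqVneq c1 0.
    exists 1, 0, g; split; first by case=> /eqP; rewrite oner_eq0.
      by rewrite AE c10 mulr0 mul0r addr0 scale0r.
    by move=> x; rewrite mul1r mul0r addr0.
  exists c2, (- c1), f; split.
  - by case=> _ /eqP; rewrite oppr_eq0 (negPf c10).
  - by rewrite AE mulNr [c2 * _]mulrC subrr scale0r.
  - move=> x e fx; split=> //; move/eqP: e.
    by rewrite fx mulr0 add0r mulf_eq0 oppr_eq0 (negPf c10) => /eqP.
set G := a *: f + b *: g in AG.
have rA : \rank A = (n./2 + 1).+2 by apply/eqP.
have W2 : (2 <= \rank (A :&: kermx G)%MS)%N.
  have := mxrank_mul_ker A G.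
  have : (\rank (A *m G) <= n.+3 - \rank A)%N.
    by rewrite -[\rank A]mxrank_tr -mxrank_ker mxrankS //; apply/sub_kermxP.
  have := rank_leq_col A; rewrite rA.
  move: (\rank (A *m G)) (\rank (A :&: kermx G)%MS) => r1 r2; lia.
have [v [+ v0 hv]] := isotropic_exists h W2.
rewrite sub_capmx => /andP[_ /sub_kermxP vG].
have vG' : a *: (v *m f) + b *: (v *m g) = 0.
  by rewrite -vG mulmxDr -!scalemxAr.
have [] := Gh v _ hv; first by rewrite -!bfZm -bfDm /bf vG mul0mx mxE.
by move=> fv gv; apply: ab0; apply: (sm v).
Qed.

(** * Simultaneous diagonalization of a smooth pencil *)

Section Diagonalization.
Variables (K : numClosedFieldType) (N : nat).
Implicit Types (f g h : 'M[K]_N.+1).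

(** A common eigenvector isotropic for g is isotropic for f, hence a singular
    point. *)
Lemma smooth_pencil_eigen f g : smooth_pencil f g -> forall (u : 'rV[K]_N.+1) a,
  u *m f = a *: (u *m g) -> bf g u u = 0 -> u = 0.
Proof.
move=> sm u a ufg gu; apply/eqP; apply: contrapT => /negP u0.
have fu : bf f u u = 0 by rewrite bf_mulmx ufg bfZl -bf_mulmx gu mulr0.
have [|/eqP] := sm u u0 fu gu 1 (- a); last by rewrite oner_eq0.
by rewrite scale1r ufg scaleNr subrr.
Qed.

(** If all members were singular, f + X g would kill a nonzero polynomial
    vector v.  Differentiating v (f + X g) = 0 and pairing with v gives
    v g v^T = 0: at every parameter t the vector v(t) is a vertex lying on the
    base locus. *)
Lemma pencil_member_unit f g : f^T = f -> g^T = g -> smooth_pencil f g ->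
  exists t, f + t *: g \in unitmx.
Proof.
move=> fT gT sm; pose M := map_mx polyC f + 'X *: map_mx polyC g.
have evM t : map_mx (horner_eval t) M = f + t *: g.
  by apply/matrixP => i j; rewrite !mxE /horner_eval !hornerE.
have [/eqP/det0P[v v0 vM]|dM] := eqVneq (\det M) 0; last first.
  have [t dt] := nonroot_exists dM; exists t.
  by rewrite unitmxE unitfE -evM det_map_mx.
exfalso; have dvM : map_mx (@deriv K) v *m M + v *m map_mx polyC g = 0.
  transitivity (map_mx (@deriv K) (v *m M)); last first.
    by rewrite vM; apply/matrixP => i j; rewrite !mxE deriv0.
  apply/matrixP => i j; rewrite !mxE linear_sum -big_split; apply: eq_bigr => k _ /=.
  rewrite derivM; congr (_ + _); first by rewrite mxE.
  by congr (_ * _); rewrite !mxE derivD derivC derivM derivX derivC mul1r mulr0 addr0 add0r.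
have mtr m n (A : 'M[{poly K}]_(m, n)) (t : K) :
    (map_mx (horner_eval t) A)^T = map_mx (horner_eval t) A^T.
  by apply/matrixP => i j; rewrite !mxE.
have MT : M^T = M.
  have mC (h : 'M[K]_N.+1) : h^T = h -> (map_mx polyC h)^T = map_mx polyC h.
    by move=> hT; rewrite -[in RHS]hT; apply/matrixP => i j; rewrite !mxE.
  by rewrite linearD linearZ /= !mC.
have vgv : v *m map_mx polyC g *m v^T = 0.
  have := congr1 (mulmx^~ v^T) dvM; rewrite mul0mx mulmxDl -(mulmxA _ M).
  have -> : M *m v^T = 0 by rewrite -MT -trmx_mul vM trmx0.
  by rewrite mulmx0 add0r.
have /rV0Pn[j vj] := v0.
(* specialize where v does not vanish *)
have [t vt] := nonroot_exists vj.
pose u : 'rV[K]_N.+1 := map_mx (horner_eval t) v.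
have evC (h : 'M[K]_N.+1) : map_mx (horner_eval t) (map_mx polyC h) = h.
  by apply/matrixP => i k; rewrite !mxE /horner_eval hornerC.
have gu : bf g u u = 0.
  have := congr1 (map_mx (horner_eval t)) vgv.
  by rewrite !map_mxM -mtr evC map_mx0 /bf => ->; rewrite mxE.
have ufg : u *m f = (- t) *: (u *m g).
  apply/eqP; rewrite -subr_eq0 -scaleNr opprK scalemxAr -mulmxDr -evM.
  by rewrite -map_mxM vM map_mx0.
have u0 := smooth_pencil_eigen sm ufg gu.
by move: vt; have /rowP/(_ j) := u0; rewrite !mxE /horner_eval => ->; rewrite eqxx.
Qed.

(** It suffices that the minimal polynomial of T = f g^-1 have simple roots.  At
    a double root a there would be u <> 0 in the image of T - a with u T = a u;
    then u f = a u g, and u is isotropic for g because f - a g is symmetric. *)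
Lemma pencil_diagonalizable f g : f^T = f -> g^T = g -> smooth_pencil f g ->
  g \in unitmx -> diagonalizable (f *m invmx g).
Proof.
move=> fT gT sm gu; set T := f *m invmx g.
have [rs rsE] := closed_field_poly_normal (mxminpoly T).
rewrite (monicP (mxminpoly_monic T)) scale1r in rsE.
apply/diagonalizableP; exists rs; last by rewrite rsE.
apply: contrapT => /negP nu.
have [a [rs' prs]] : exists a rs', perm_eq rs [:: a, a & rs'].
  elim: rs {rsE} nu => [|x s IH] //=; rewrite negb_and negbK.
  have [xs _|_ /IH[b [r sr]]] := boolP (x \in s).
    by exists x, (rem x s); rewrite perm_cons perm_to_rem.
  exists b, (x :: r); apply: (@perm_trans _ [:: x, b, b & r]); first by rewrite perm_cons.
  by apply/permP => p /=; lia.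
have mE : mxminpoly T = ('X - a%:P) * (('X - a%:P) * \prod_(z <- rs') ('X - z%:P)).
  by rewrite rsE (perm_big _ prs) !big_cons.
set q := \prod_(z <- rs') _ in mE.
have Ta w : w *m T = w *m f *m invmx g by rewrite /T mulmxA.
have S0 : horner_mx T (('X - a%:P) * q) = 0.
  apply/row_matrixP => i; rewrite row0 rowE.
  set w := delta_mx _ _; set u := w *m _.
  have uE : u = w *m horner_mx T q *m (T - a%:M).
    by rewrite /u mulrC rmorphM /= mulmxA rmorphB /= horner_mx_X horner_mx_C.
  have uT : u *m (T - a%:M) = 0.
    have := mx_root_minpoly T; rewrite mE mulrC rmorphM rmorphB /= horner_mx_X horner_mx_C.
    by move=> /(congr1 (mulmx w)); rewrite mulmx0 mulmxA.
  have Tg v : v *m (T - a%:M) *m g = v *m f - a *: (v *m g).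
    by rewrite mulmxBr mulmxBl /T mulmxA mulmxKV // mul_mx_scalar scalemxAl.
  have uf : u *m f = a *: (u *m g).
    by apply/eqP; rewrite -subr_eq0 -Tg uT mul0mx.
  apply: (smooth_pencil_eigen sm uf).
  set v := w *m horner_mx T q in uE.
  have fgT : (f - a *: g)^T = f - a *: g by rewrite linearB linearZ /= fT gT.
  transitivity (bf (f - a *: g) v u).
    by rewrite /bf {1}uE Tg mulmxBr scalemxAr.
  by rewrite bfC // /bf mulmxBr -scalemxAr uf subrr mul0mx mxE.
have := mxminpoly_min S0; rewrite mE.
have q0 : q != 0 by apply/monic_neq0/monic_prod_XsubC.
move=> /dvdp_leq; rewrite mulf_neq0 ?polyXsubC_eq0 // => /(_ isT).
rewrite [X in (X <= _)%N]size_mul ?mulf_neq0 ?polyXsubC_eq0 //.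
by rewrite size_XsubC /= ltnn.
Qed.

(** Eigenvectors for distinct eigenvalues are orthogonal, and an eigenvalue
    cannot occur twice: its eigenspace would contain an isotropic vector. *)
Lemma smooth_pencil_diag f g : f^T = f -> g^T = g -> smooth_pencil f g ->
  g \in unitmx -> exists (P : 'M[K]_N.+1) (l : 'rV[K]_N.+1),
  [/\ P \in unitmx, P *m g *m P^T = 1%:M, P *m f *m P^T = diag_mx l &
      injective (l 0)].
Proof.
move=> fT gT sm gu.
have [P Pu /(diagonalizable_forLR Pu)[l TE]] := pencil_diagonalizable fT gT sm gu.
rewrite mxpoly.conjumx ?unitmx_inv // invmxK in TE.
have Pf : P *m f = diag_mx l *m (P *m g).
  by rewrite -[f](mulmxKV gu) TE !mulmxA mulmxV // mul1mx.
have [G GP] : exists G, P *m g *m P^T = G by exists (P *m g *m P^T).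
have GT : G^T = G by rewrite -GP; apply: congr_sym.
have Gu : G \in unitmx by rewrite -GP !unitmx_mul Pu gu unitmx_tr Pu.
have PfE : P *m f *m P^T = diag_mx l *m G by rewrite Pf -GP !mulmxA.
have rowf i : row i P *m f = l 0 i *: (row i P *m g).
  by apply/rowP => k; rewrite -!row_mul Pf mul_diag_mx !mxE.
have l_inj : injective (l 0).
  move=> i j lij; apply: contrapT => /eqP ij.
  pose W := col_mx (row i P) (row j P).
  have W2 : (2 <= \rank W)%N.
    suff /eqP-> : row_free W by [].
    apply: inj_row_free => u; rewrite -[u]hsubmxK mul_row_col.
    move=> /(congr1 (mulmx^~ (invmx P))).
    rewrite mul0mx mulmxDl -!mulmxA -!row_mul mulmxV // !row1 => e.
    have uk k : (lsubmx u *m delta_mx 0 i + rsubmx u *m delta_mx 0 j) 0 k =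
        lsubmx u 0 0 * (k == i)%:R + rsubmx u 0 0 * (k == j)%:R.
      by rewrite mxE !(mxE, big_ord1).
    have := uk i; have := uk j; rewrite e !mxE !eqxx (negPf ij) eq_sym (negPf ij).
    rewrite !mulr0 !mulr1 addr0 add0r => u2 u1; apply/rowP => k.
    by rewrite !mxE; case: splitP => k' _; rewrite !ord1 !mxE.
  have [v [vW v0 gv]] := isotropic_exists g W2.
  move/eqP: v0; apply; apply: (smooth_pencil_eigen sm (a := l 0 i)) => //.
  move: vW; rewrite -addsmxE => /sub_addsmxP[[u1 u2] /= ->].
  rewrite !mulmxDl -!mulmxA !rowf -lij !scalemxAr -!scalemxAr.
  by rewrite scalerDr.
have Goff i j : i != j -> G i j = 0.
  move=> ij; have : (diag_mx l *m G)^T = diag_mx l *m G by rewrite -PfE congr_sym.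
  move=> /matrixP/(_ i j); rewrite mxE !mul_diag_mx !mxE.
  have -> : G j i = G i j by rewrite -{1}GT mxE.
  move=> /eqP; rewrite -subr_eq0 -mulrBl mulf_eq0 subr_eq0 (inj_eq l_inj).
  by rewrite eq_sym (negPf ij) => /eqP.
have GE : G = diag_mx (\row_i G i i).
  apply/matrixP => i j; rewrite !mxE; have [->|ij] := eqVneq i j; first by rewrite mulr1n.
  by rewrite mulr0n Goff.
have Gii i : G i i != 0.
  move: Gu; rewrite GE unitmxE det_diag unitfE => /prodf_neq0/(_ i isT).
  by rewrite !mxE eqxx mulr1n.
(* rescale the eigenvectors to norm 1 *)
pose s : 'rV[K]_N.+1 := \row_i (sqrtC (G i i))^-1.
have su : diag_mx s \in unitmx.
  rewrite unitmxE det_diag unitfE; apply/prodf_neq0 => i _.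
  by rewrite mxE invr_eq0 sqrtC_eq0.
have sGs : diag_mx s *m G *m diag_mx s = 1%:M.
  rewrite {1}GE !mulmx_diag -diag_const_mx; congr diag_mx.
  apply/rowP => i; rewrite !mxE -[X in _ * X * _]sqrtCK expr2.
  by rewrite mulrA mulVf ?mul1r ?mulfV ?sqrtC_eq0.
exists (diag_mx s *m P), l; split=> //.
- by rewrite unitmx_mul su.
- by rewrite trmx_mul tr_diag_mx -[RHS]sGs -GP !mulmxA.
- rewrite trmx_mul tr_diag_mx -[RHS]mulmx1 -sGs.
  transitivity (diag_mx s *m (P *m f *m P^T) *m diag_mx s); first by rewrite !mulmxA.
  by rewrite PfE !mulmxA diag_mxC.
Qed.

End Diagonalization.

(** * Isotropic subspaces through two given points *)

Section ThirdVector.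
Variables (K : numClosedFieldType) (d : nat).
Implicit Types (g : 'M[K]_d) (E : 'M[K]_(2, d)) (v y z : 'rV[K]_d).

(** The double orthogonal of a row space is the row space itself. *)
Lemma submx_tr_of_kermx_orth j (C : 'M[K]_(d, j)) v :
  (forall z, (z <= kermx C)%MS -> bf 1%:M v z = 0) -> (v <= C^T)%MS.
Proof.
move=> h; rewrite submxE; apply/eqP.
have cC : ((cokermx C^T)^T <= kermx C)%MS.
  apply/sub_kermxP; apply: trmx_inj.
  by rewrite trmx_mul trmxK mulmx_coker trmx0.
have := @bf_gram_eq0 _ _ 1 _ 1%:M v (cokermx C^T)^T; rewrite trmxK mulmx1; apply.
move=> x z /sub_rVP[a ->] zC; rewrite bfZl h ?mulr0 //.
exact: submx_trans zC cC.
Qed.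

Definition common_perp g E : 'M[K]_d := kermx (row_mx E^T (g *m E^T)).

Lemma common_perpP g E y :
  reflect (y *m E^T = 0 /\ y *m g *m E^T = 0) (y <= common_perp g E)%MS.
Proof.
apply: (iffP sub_kermxP); rewrite mul_mx_row mulmxA.
  by move=> e; apply: eq_row_mx; rewrite row_mx0.
by case=> -> ->; rewrite row_mx0.
Qed.

(** The orthogonal of U is spanned by E and E g; the component in E vanishes
    when v is orthogonal to E, since g vanishes on E and the dot product does
    not degenerate there. *)
Lemma orth_common_perp g E v : g^T = g -> E *m E^T \in unitmx ->
  E *m g *m E^T = 0 -> v *m E^T = 0 ->
  (forall z, (z <= common_perp g E)%MS -> bf 1%:M v z = 0) ->
  exists2 e, (e <= E)%MS & v = e *m g.
Proof.
move=> gT EE Eg vE /submx_tr_of_kermx_orth.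
rewrite tr_row_mx trmx_mul trmxK gT -addsmxE => /sub_addsmxP[[a b] /= vab].
exists (b *m E); first exact: submxMl.
have : (a *m E + b *m (E *m g)) *m E^T = 0 by rewrite -vab.
rewrite mulmxDl -!mulmxA (mulmxA E) Eg mulmx0 addr0 => /(congr1 (mulmx^~ (invmx (E *m E^T)))).
by rewrite mulmxK // mul0mx => a0; rewrite vab a0 mul0mx add0r mulmxA.
Qed.

(** The two hypotheses exclude the two obstructions of [isotropic_separates]: a
    vector of U that is g-orthogonal to U, and the proportionality of g and the
    dot product on U. *)
Lemma exists_third g E : g^T = g -> E *m E^T \in unitmx -> E *m g *m E^T = 0 ->
  (2 <= \rank (common_perp g E))%N ->
  (forall y e, (y <= common_perp g E)%MS -> (e <= E)%MS -> y *m g = e *m g -> y = 0) ->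
  (forall c, ~ forall y, (y <= common_perp g E)%MS ->
     exists2 e, (e <= E)%MS & y - c *: (y *m g) = e *m g) ->
  exists y, [/\ (y <= common_perp g E)%MS, bf g y y = 0 & bf 1%:M y y != 0].
Proof.
move=> gT EE Eg U2 h1 h2; apply: isotropic_separates => //.
- exact: trmx1.
- move=> y yU yz; have [yE ygE] := common_perpP _ _ _ yU.
  have [|e eE ye] := orth_common_perp gT EE Eg ygE; last exact: (h1 y e).
  by move=> z zU; rewrite -bf_mulmx yz.
- move=> c fc; apply: (h2 c) => y yU; have [yE ygE] := common_perpP _ _ _ yU.
  apply: orth_common_perp => //.
    by rewrite mulmxBl yE -scalemxAl ygE scaler0 subrr.
  move=> z zU; have sT : (1%:M - c *: g)^T = 1%:M - c *: g.
    by rewrite linearB linearZ /= trmx1 gT.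
  have -> : y - c *: (y *m g) = y *m (1%:M - c *: g).
    by rewrite mulmxBr mulmx1 scalemxAr.
  rewrite -bf_mulmx; apply: bf_polar yU zU => // x xU.
  by rewrite bfDm -scaleNr bfZm fc // mulNr subrr.
Qed.

(** The kernel of g meets E in dimension at least [c]; the bound on t is that of
    [isotropic_extend], applied to E + y. *)
Lemma span_of_third g E y c t : g^T = g -> E *m E^T \in unitmx ->
  E *m g *m E^T = 0 -> (\rank (E *m g) + c <= 2)%N ->
  (y <= common_perp g E)%MS -> bf g y y = 0 -> bf 1%:M y y != 0 ->
  (3 <= t)%N -> (t.*2 <= d + c)%N ->
  exists L : 'M[K]_(t, d), [/\ row_free L, (E <= L)%MS, L *m g *m L^T = 0 &
    (3 <= \rank (L *m L^T))%N].
Proof.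
move=> gT EE Eg Ec /common_perpP[yE ygE] gy yy t3 td.
pose W := <<col_mx E y>>%MS.
have EyT : E *m y^T = 0.
  by apply: trmx_inj; rewrite trmx_mul trmxK yE trmx0.
have gram3 k (L : 'M[K]_(k, d)) : (E <= L)%MS -> (y <= L)%MS -> (3 <= \rank (L *m L^T))%N.
  move=> EL yL; have := @gram_rank_ge3 _ _ _ 1%:M E y L (trmx1 _ _).
  by rewrite !mulmx1; apply.
have [EW yW] : (E <= W)%MS /\ (y <= W)%MS.
  by apply/andP; rewrite -col_mx_sub genmxE.
have rW : \rank W = 3%N.
  apply/eqP; rewrite eqn_leq genmxE rank_leq_row -genmxE.
  exact: leq_trans (gram3 _ _ EW yW) (mxrankM_maxl _ _).
have Wg : W *m g *m W^T = 0.
  apply: bf_gram_eq0 => u v; rewrite !genmxE -!addsmxE.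
  move=> /sub_addsmxP[[a1 a2] /= ->] /sub_addsmxP[[b1 b2] /= ->].
  have sv (a : 'M[K]_1) : (a *m y <= y)%MS by rewrite submxMl.
  have sE (a : 'M[K]_(1, 2)) : (a *m E <= E)%MS by rewrite submxMl.
  rewrite !(bfDl, bfDr) (gram_eq0_bf Eg (sE _) (sE _)) (gram_eq0_bf ygE (sv _) (sE _)).
  rewrite (bfC _ _ gT) (gram_eq0_bf ygE (sv _) (sE _)) !add0r.
  apply: (gram_eq0_bf _ (sv a2) (sv b2)).
  by apply/matrixP => i j; rewrite !ord1 [RHS]mxE.
have rWg : (\rank (W *m g) <= \rank (E *m g) + 1)%N.
  rewrite (eqmxMr g (genmxE _)) mul_col_mx -addsmxE.
  apply: (leq_trans (mxrank_adds_leqif _ _)).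
  by rewrite leq_add2l rank_leq_row.
have [||L [L0 WL rL]] := @isotropic_extend _ _ g W c t gT Wg _ _ td; rewrite ?rW //.
  by rewrite (leq_trans (leq_add rWg (leqnn c))) // addnAC addn1 ltnS.
rewrite -rL.
exists (row_base L); split.
- exact: row_base_free.
- by rewrite eq_row_base (submx_trans EW).
- by apply: bf_gram_eq0 => u v; rewrite !eq_row_base; apply: gram_eq0_bf.
- by apply: gram3; rewrite eq_row_base ?(submx_trans EW) ?(submx_trans yW).
Qed.

End ThirdVector.

(** * The base locus of a diagonal pencil *)

Section DiagonalPencil.
Variables (K : numClosedFieldType) (d : nat) (l : 'rV[K]_d).
Implicit Types (h : 'M[K]_d) (p q u v w x y z : 'rV[K]_d) (i j k : 'I_d).

Local Notation D := (diag_mx l).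
Local Notation dot := (bf 1%:M).
Local Notation e_ i := (delta_mx 0 i : 'rV[K]_d).

Lemma dotE x y : dot x y = \sum_i x 0 i * y 0 i.
Proof. by rewrite /bf mulmx1 mxE; apply: eq_bigr => i _; rewrite mxE. Qed.

Lemma bf_diag x y : bf D x y = \sum_i l 0 i * (x 0 i * y 0 i).
Proof.
rewrite /bf mxE; apply: eq_bigr => i _.
by rewrite mul_mx_diag !mxE; ring.
Qed.

Lemma bf_delta h i j : bf h (e_ i) (e_ j) = h i j.
Proof. by rewrite /bf -rowE trmx_delta -colE !mxE. Qed.

Lemma dotC x y : dot x y = dot y x.
Proof. by apply: bfC; rewrite trmx1. Qed.

Lemma dot_delta x i : dot x (e_ i) = x 0 i.
Proof. by rewrite /bf mulmx1 trmx_delta -colE mxE. Qed.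

Lemma bf_rank1 v w x : bf (v^T *m w) x x = dot x v * dot x w.
Proof. by rewrite (dotC x w) /bf !mulmx1 mulmxA -mulmxA mxE big_ord1. Qed.

(** The cone over the base locus, in coordinates where the pencil is spanned by
    diag(l) and the identity. *)
Definition diag_locus : set 'rV[K]_d :=
  [set x | [/\ x != 0, bf D x x = 0 & dot x x = 0]].

(** The change of sign of the i-th coordinate, as a translate of x. *)
Definition flip i x : 'rV[K]_d := x - (2 * x 0 i) *: e_ i.

Lemma flipE i x k : flip i x 0 k = if k == i then - x 0 k else x 0 k.
Proof.
rewrite !mxE eqxx /=; have [->|ki] := eqVneq k i; last by rewrite mulr0 subr0.
by rewrite mulr1; ring.
Qed.

Lemma flip_locus i x : diag_locus x -> diag_locus (flip i x).
Proof.
have sq k : flip i x 0 k * flip i x 0 k = x 0 k * x 0 k.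
  by rewrite flipE; case: ifP => _; rewrite ?mulrNN.
move=> [x0 Dx dx]; split.
- apply: contraNneq x0 => e; apply/eqP/rowP => k; rewrite mxE.
  by apply/eqP; rewrite -sqrf_eq0 expr2 -sq e mxE mulr0.
- by rewrite -Dx !bf_diag; apply: eq_bigr => k _; rewrite sq.
- by rewrite -dx !dotE; apply: eq_bigr => k _; rewrite sq.
Qed.

(** A linear form takes distinct values at x and at [flip i x] if its i-th
    coefficient is nonzero. *)
Lemma linear_nonzero x q :
  diag_locus x -> (forall i, x 0 i != 0) -> q != 0 ->
  exists2 z, diag_locus z & bf (q^T *m q) z z != 0.
Proof.
move=> Lx xn0 /rV0Pn[i qi]; apply: contrapT => h.
have dq z : diag_locus z -> dot z q = 0.
  move=> Lz; apply/eqP; rewrite -sqrf_eq0 expr2 -bf_rank1; apply: contrapT => /negP az.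
  by apply: h; exists z.
have := dq _ (flip_locus i Lx).
rewrite bfDl -scaleNr bfZl dq // add0r (dotC _ q) dot_delta => /eqP.
by rewrite mulf_eq0 oppr_eq0 mulf_eq0 pnatr_eq0 (negPf (xn0 i)) (negPf qi).
Qed.

(** The second difference of h along the two sign changes i and j only retains
    the term in x_i x_j. *)
Lemma offdiag_nonzero x h i j :
  diag_locus x -> (forall i, x 0 i != 0) -> i != j -> h i j + h j i != 0 ->
  exists2 z, diag_locus z & bf h z z != 0.
Proof.
move=> Lx xn0 ij hij; apply: contrapT => none.
have hz z : diag_locus z -> bf h z z = 0.
  by move=> Lz; apply: contrapT => /eqP az; apply: none; exists z.
have := hz _ (flip_locus i (flip_locus j Lx)).
have := hz _ (flip_locus j Lx); have := hz _ (flip_locus i Lx); have := hz _ Lx.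
rewrite [flip i (flip j x)]/flip flipE (negPf ij) /flip.
rewrite -!scaleN1r !(bfDl, bfDr, bfZl, bfZr) !bf_delta => h1 h2 h3 h4.
have : 4 * x 0 i * x 0 j * (h i j + h j i) == 0.
  apply/eqP; rewrite -[RHS](addr0 0) -{1}h1 -[X in _ = _ + X]addr0 -{1}h4.
  rewrite -[X in _ = _ + (_ + X)]oppr0 -[X in _ = _ + (_ + - X)]addr0 -{1}h2 -{1}h3.
  ring.
by rewrite !mulf_eq0 pnatr_eq0 (negPf (xn0 i)) (negPf (xn0 j)) (negPf hij).
Qed.

Hypothesis l_inj : injective (l 0).

(** Three coordinates suffice: the squares l_j - l_k, l_k - l_i and l_i - l_j
    satisfy both equations. *)
Lemma locus_point_neq0 i : (3 <= d)%N -> exists2 x, diag_locus x & x 0 i != 0.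
Proof.
move=> d3; have [j [k [ij ik jk]]] : exists j k, [/\ i != j, i != k & j != k].
  have [j] : exists j, j \in ~: [set i].
    by apply/finset.set0Pn; rewrite -card_gt0 cardsCs finset.setCK cards1 card_ord; lia.
  rewrite !inE => ji; have [k] : exists k, k \in ~: [set i; j].
    by apply/finset.set0Pn; rewrite -card_gt0 cardsCs finset.setCK cards2 card_ord; lia.
  rewrite !inE negb_or => /andP[ki kj].
  by exists j, k; rewrite !(eq_sym i) (eq_sym j k).
pose s a b := sqrtC (l 0 a - l 0 b).
have s2 a b : s a b * s a b = l 0 a - l 0 b by rewrite -expr2 sqrtCK.
pose x : 'rV[K]_d := s j k *: e_ i + s k i *: e_ j + s i j *: e_ k.
have [ji ki kj] : [/\ j != i, k != i & k != j] by rewrite !(eq_sym _ i) (eq_sym k).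
have xi : x 0 i = s j k.
  by rewrite !mxE !eqxx /= (negPf ij) (negPf ik) !mulr0 mulr1 !addr0.
have xi0 : x 0 i != 0.
  by rewrite xi sqrtC_eq0 subr_eq0 (inj_eq l_inj).
have dx (g : 'M[K]_d) (r : 'I_d -> K) : g = diag_mx (\row_i r i) ->
    bf g x x = r i * (l 0 j - l 0 k) + r j * (l 0 k - l 0 i) + r k * (l 0 i - l 0 j).
  move=> ->; rewrite !(bfDl, bfDr, bfZl, bfZr) !bf_delta !mxE !eqxx.
  rewrite (negPf ij) (negPf ik) (negPf jk) (negPf ji) (negPf ki) (negPf kj) /=.
  by rewrite -!s2; ring.
exists x => //; split.
- by apply: contraNneq xi0 => ->; rewrite mxE.
- rewrite (dx _ (l 0)); first by ring.
  by congr diag_mx; apply/rowP => a; rewrite mxE.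
- rewrite (dx _ (fun=> 1)); first by ring.
  by rewrite -diag_const_mx; congr diag_mx; apply/rowP => a; rewrite !mxE.
Qed.

Lemma locus_two_coords p i : diag_locus p -> p 0 i != 0 ->
  exists2 j, i != j & p 0 j != 0.
Proof.
move=> [_ _ pp] pi; apply: contrapT => none; move/eqP: pp; rewrite dotE (bigD1 i) //=.
rewrite big1 => [|j ji]; first by rewrite addr0 mulf_eq0 orbb (negPf pi).
suff -> : p 0 j = 0 by rewrite mulr0.
by apply: contrapT => /eqP pj; apply: none; exists j => //; rewrite eq_sym.
Qed.

(** Since g is injective, 1 - c g vanishes at one index at most, so y would be a
    multiple of a basis vector, which is not orthogonal to x. *)
Lemma kernel_support x y (g : 'I_d -> K) c : injective g ->
  (forall i, x 0 i != 0) -> dot y x = 0 ->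
  (forall i, y 0 i * (1 - c * g i) = 0) -> y = 0.
Proof.
move=> g_inj xn0 yx yg; apply: contrapT => /eqP y0.
have /rV0Pn[i yi] := y0.
have e k : y 0 k != 0 -> c * g k = 1.
  move=> yk; have /eqP := yg k; rewrite mulf_eq0 (negPf yk) subr_eq0 /=.
  by move=> /eqP.
have yj j : j != i -> y 0 j = 0.
  move=> ji; apply: contrapT => /eqP /e yj; have yi' := e i yi.
  have c0 : c != 0 by apply: contra_eq_neq yj => ->; rewrite mul0r eq_sym oner_neq0.
  by move/eqP: ji; apply; apply: g_inj; apply: (mulfI c0); rewrite yj yi'.
move/eqP: yx; rewrite dotE (bigD1 i) //= big1 ?addr0 => [|j /yj ->]; last by rewrite mul0r.
by rewrite mulf_eq0 (negPf yi) (negPf (xn0 i)).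
Qed.

End DiagonalPencil.

(** * Spans of quadrics for a diagonal pencil *)

Section Pairs.
Variables (K : numClosedFieldType) (d : nat).
Implicit Types (g : 'M[K]_d) (p x y : 'rV[K]_d).
Local Notation dot := (bf 1%:M).

Lemma sub_pairP p x y : (y <= col_mx p x)%MS ->
  exists a b, y = a *: p + b *: x.
Proof.
rewrite -addsmxE => /sub_addsmxP[[u v] /= ->].
by exists (u 0 0), (v 0 0); rewrite -!mul_scalar_mx -!mx11_scalar.
Qed.

Lemma pair_sub p x : (p <= col_mx p x)%MS /\ (x <= col_mx p x)%MS.
Proof. by apply/andP; rewrite -col_mx_sub. Qed.

Lemma pair_common_perp g p x y : (y <= common_perp g (col_mx p x))%MS ->
  [/\ dot y p = 0, dot y x = 0, bf g y p = 0 & bf g y x = 0].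
Proof.
have [pE xE] := pair_sub p x => /common_perpP[yE gE].
split; try by apply: (gram_eq0_bf gE).
  by apply: (@gram_eq0_bf _ _ _ _ 1%:M y (col_mx p x)); rewrite ?mulmx1.
by apply: (@gram_eq0_bf _ _ _ _ 1%:M y (col_mx p x)); rewrite ?mulmx1.
Qed.

(** The Gram matrix is antitriangular with p.x off the diagonal. *)
Lemma pair_gram_unit p x : dot x x = 0 -> dot p x != 0 ->
  col_mx p x *m (col_mx p x)^T \in unitmx.
Proof.
move=> xx px; rewrite -row_free_unit; apply: inj_row_free => v.
rewrite mulmxA => vE; have [pE xE] := pair_sub p x.
have v0 z : (z <= col_mx p x)%MS -> dot (v *m col_mx p x) z = 0.
  move=> zE; apply: (gram_eq0_bf _ (submx_refl _) zE).
  by rewrite mulmx1.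
have := v0 x xE; have := v0 p pE.
have -> : v *m col_mx p x = lsubmx v 0 0 *: p + rsubmx v 0 0 *: x.
  by rewrite -[v in LHS]hsubmxK mul_row_col -!mul_scalar_mx -!mx11_scalar.
rewrite !(bfDl, bfZl) xx mulr0 addr0 (dotC x p) => e2 /eqP.
rewrite mulf_eq0 (negPf px) orbF => /eqP e1; move: e2.
rewrite e1 mul0r add0r => /eqP; rewrite mulf_eq0 (negPf px) orbF => /eqP e2.
by rewrite -[v]hsubmxK [lsubmx v]mx11_scalar [rsubmx v]mx11_scalar e1 e2 !raddf0 row_mx0.
Qed.

Lemma pair_gram0 g p x : g^T = g -> bf g p p = 0 -> bf g p x = 0 -> bf g x x = 0 ->
  col_mx p x *m g *m (col_mx p x)^T = 0.
Proof.
move=> gT pp px xx; apply: bf_gram_eq0 => u v /sub_pairP[a [b ->]] /sub_pairP[a' [b' ->]].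
by rewrite !(bfDl, bfDr, bfZl, bfZr) (bfC x p gT) pp px xx; ring.
Qed.

Lemma common_perp_rank g (E : 'M[K]_(2, d)) r :
  g^T = g -> (\rank (E *m g) <= r)%N -> (d - (2 + r) <= \rank (common_perp g E))%N.
Proof.
move=> gT rE; rewrite mxrank_ker leq_sub2l // -mxrank_tr tr_row_mx trmx_mul trmxK gT.
rewrite -addsmxE (leq_trans (mxrank_adds_leqif _ _)) //.
by rewrite leq_add // rank_leq_row.
Qed.

(** On an isotropic space of a f + b the form f is a multiple of the dot
    product. *)
Lemma proportional_gram t (L : 'M[K]_(t, d)) f a b : a != 0 ->
  L *m (a *: f + b *: 1%:M) *m L^T = 0 -> L *m f *m L^T = (- b / a) *: (L *m L^T).
Proof.
move=> a0; rewrite mulmxDr mulmxDl -!scalemxAr -!scalemxAl mulmx1 => /eqP.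
rewrite addr_eq0 => /eqP/(congr1 ( *:%R a^-1)).
by rewrite scalerA mulVf // scale1r => ->; rewrite -scaleNr scalerA mulrC.
Qed.

End Pairs.

Section DiagonalSpans.
Variables (K : numClosedFieldType) (n : nat) (l : 'rV[K]_n.+3).
Hypothesis l_inj : injective (l 0).
Implicit Types (x y p u : 'rV[K]_n.+3).
Local Notation D := (diag_mx l).
Local Notation dot := (bf 1%:M).

Lemma row_subZ y u c k : (y - c *: u) 0 k = y 0 k - c * u 0 k.
Proof. by rewrite !mxE. Qed.

Lemma row_addZ a b y u k : (a *: y + b *: u) 0 k = a * y 0 k + b * u 0 k.
Proof. by rewrite !mxE. Qed.

Lemma pencil_sym a b : (a *: D + b *: 1%:M)^T = a *: D + b *: 1%:M.
Proof. by rewrite linearD !linearZ /= tr_diag_mx trmx1. Qed.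

Lemma pencil_entry a b y k :
  (y *m (a *: D + b *: 1%:M)) 0 k = y 0 k * (a * l 0 k + b).
Proof.
by rewrite mulmxDr -!scalemxAr mulmx1 mul_mx_diag !mxE; ring.
Qed.

Lemma bf_pencil a b x y : bf (a *: D + b *: 1%:M) x y = a * bf D x y + b * dot x y.
Proof. by rewrite bfDm !bfZm. Qed.

(** The vertex e belongs to the kernel of G, which gives the extra dimension
    that an isotropic subspace of dimension m + 2 requires in dimension
    2m + 3. *)
Lemma span_through_vertex m x : n = m.*2 -> (0 < m)%N ->
  diag_locus l x -> (forall i, x 0 i != 0) ->
  exists (L : 'M[K]_(m.+2, n.+3)) c, [/\ row_free L, (x <= L)%MS,
    (3 <= \rank (L *m L^T))%N & L *m D *m L^T = c *: (L *m L^T)].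
Proof.
move=> nm m0 [x0 Dx dx] xn0.
pose e : 'rV[K]_n.+3 := delta_mx 0 0.
pose E := col_mx e x.
pose G : 'M[K]_n.+3 := 1 *: D + (- l 0 0) *: 1%:M.
have GT : G^T = G by exact: pencil_sym.
have Gent y k : (y *m G) 0 k = y 0 k * (l 0 k - l 0 0).
  by rewrite pencil_entry mul1r.
have eG : e *m G = 0.
  apply/rowP => k; rewrite Gent !mxE eqxx /=.
  by have [->|k0] := eqVneq k 0; rewrite ?subrr ?mulr0 ?mul0r.
have bfe y : bf G e y = 0 by rewrite bf_mulmx eG bf0l.
have Gx : bf G x x = 0 by rewrite bf_pencil Dx dx !mulr0 addr0.
have ye y : dot y e = y 0 0 by rewrite dot_delta.
have EE : E *m E^T \in unitmx by apply: pair_gram_unit; rewrite // dotC ye.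
have EG : E *m G *m E^T = 0 by apply: pair_gram0; rewrite ?bfe.
have rEG : (\rank (E *m G) <= 1)%N.
  rewrite mul_col_mx eG -addsmxE (leq_trans (mxrank_adds_leqif _ _)) //.
  by rewrite mxrank0 add0n rank_leq_row.
have U2 : (2 <= \rank (common_perp G E))%N.
  by apply: leq_trans (common_perp_rank GT rEG); lia.
have Gi i : i != 0 -> l 0 i - l 0 0 != 0 by move=> i0; rewrite subr_eq0 (inj_eq l_inj).
have [|c hc|y [yU Gy dy]] := exists_third GT EE EG U2.
- move=> y v yU /sub_pairP[a [b ->]] yGv; have [+ yx _ _] := pair_common_perp yU.
  rewrite ye => ye0.
  have yk k : k != 0 -> y 0 k = b * x 0 k.
    move=> k0; have /rowP/(_ k) := yGv; rewrite mulmxDl -!scalemxAl eG scaler0 add0r.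
    rewrite Gent mxE Gent mulrA; exact: mulIf (Gi k k0) _ _.
  have yE : y = b *: x - (b * x 0 0) *: e.
    apply/rowP => k; rewrite !mxE; have [->|k0] := eqVneq k 0.
      by rewrite eqxx ye0 mulr1 subrr.
    by rewrite eqxx /= mulr0 subr0 yk.
  have : b * x 0 0 * x 0 0 = 0.
    move: yx; rewrite yE bfDl -scaleNr !bfZl dx mulr0 add0r dotC ye mulNr.
    by move/eqP; rewrite oppr_eq0 => /eqP.
  move/eqP; rewrite !mulf_eq0 (negPf (xn0 0)) !orbF => /eqP b0.
  by rewrite yE b0 mul0r !scale0r subrr.
- pose i1 : 'I_n.+3 := lift 0 0.
  have [y [yU /eqP y0 yc]] :=
    (* the vanishing of the i1-th entry of y (1 - c G) forces e = b x to be zero *)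
    exists_submx_ker ((1%:M - c *: G) *m (delta_mx i1 0 : 'cV[K]_n.+3)) U2.
  apply: y0; have [_ yx _ _] := pair_common_perp yU.
  have [v /sub_pairP[a [b ->]] yv] := hc y yU.
  have yvE k : y 0 k * (1 - c * (l 0 k - l 0 0)) = b * (x 0 k * (l 0 k - l 0 0)).
    have z0 : (0 : 'rV[K]_n.+3) 0 k = 0 by rewrite mxE.
    have /rowP/(_ k) := yv.
    rewrite mulmxDl -!scalemxAl row_addZ row_subZ eG z0 !Gent => e1.
    by rewrite -[RHS]add0r -(mulr0 a) -e1; ring.
  apply: (kernel_support (g := fun k => l 0 k - l 0 0) (c := c) _ xn0 yx).
    by move=> j k /addIr/l_inj.
  have b0 : b = 0.
    move/matrixP/(_ 0 0): yc; rewrite mulmxA mulmxBr mulmx1 -scalemxAr -colE mxE.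
    rewrite row_subZ Gent [RHS]mxE => yc1; have := yvE i1.
    rewrite mulrBr mulr1 (mulrCA _ c) yc1 => /esym/eqP.
    by rewrite !mulf_eq0 (negPf (xn0 _)) (negPf (Gi i1 _)) // !orbF => /eqP.
  by move=> k; rewrite yvE b0 mul0r.
- have [|||L [Lf EL LG L3]] := @span_of_third _ _ G E y 1 m.+2 GT EE EG _ yU Gy dy.
  + by rewrite addn1 ltnS.
  + by [].
  + by lia.
  exists L, (l 0 0 / 1); split=> //; first by rewrite (submx_trans _ EL) ?(pair_sub e x).2.
  by have := proportional_gram (oner_neq0 _) LG; rewrite opprK.
Qed.

(** Clearing denominators gives a polynomial in mu; its value at l_j is a
    nonzero multiple of p_j^2. *)
Lemma resolvent_roots p : p != 0 -> exists rs : seq K, forall mu,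
  (forall i, l 0 i != mu) -> \sum_i p 0 i ^+ 2 / (l 0 i - mu) = 0 -> mu \in rs.
Proof.
move=> p0; have /rV0Pn[j pj] := p0.
pose F : {poly K} := \sum_i p 0 i ^+ 2 *: \prod_(k | k != i) ((l 0 k)%:P - 'X).
have FE mu : F.[mu] = \sum_i p 0 i ^+ 2 * \prod_(k | k != i) (l 0 k - mu).
  rewrite horner_sum; apply: eq_bigr => i _; rewrite hornerZ horner_prod.
  by congr (_ * _); apply: eq_bigr => k _; rewrite !hornerE.
have F0 : F != 0.
  apply: contraNneq pj => F0; have := FE (l 0 j); rewrite F0 horner0 (bigD1 j) //=.
  rewrite [X in _ + X]big1 => [|i ij]; last first.
    by rewrite (bigD1 j) 1?eq_sym //= subrr mul0r mulr0.
  rewrite addr0 => /esym/eqP; rewrite mulf_eq0 sqrf_eq0 => /orP[//|].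
  by rewrite prodf_seq_eq0 => /hasP[k _ /andP[kj]]; rewrite subr_eq0 (inj_eq l_inj) (negPf kj).
have [rs rsE] := closed_field_poly_normal F; exists rs => mu lmu sum0.
have FP : F.[mu] = (\prod_k (l 0 k - mu)) * \sum_i p 0 i ^+ 2 / (l 0 i - mu).
  rewrite FE mulr_sumr; apply: eq_bigr => i _; rewrite [in RHS](bigD1 i) //=.
  have : l 0 i - mu != 0 by rewrite subr_eq0.
  by move: (\prod_(k | _) _) => P lm; field.
have : root F mu by rewrite /root FP sum0 mulr0.
by rewrite rsE rootZ ?lead_coef_eq0 // root_prod_XsubC.
Qed.

(** As a form in x this is (p.x) f(u, x) - f(p, x) (u.x): the member of the
    pencil vanishing on the line from p to x, evaluated at u and x. *)
Definition wedge p u : 'M[K]_n.+3 := p^T *m (u *m D) - (p *m D)^T *m u.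

Lemma bf_wedge p u x : bf (wedge p u) x x = dot p x * bf D u x - bf D p x * dot u x.
Proof.
by rewrite bfDm -scaleN1r bfZm !bf_rank1 !(dotC x) -!bf_mulmx; ring.
Qed.

(** The diagonal coefficients of the form are zero, the other ones are
    l_j - l_i times the minors of p and u. *)
Lemma wedge_nonzero x p u i j : diag_locus l x -> (forall i, x 0 i != 0) ->
  p 0 i * u 0 j != p 0 j * u 0 i ->
  exists2 z, diag_locus l z & bf (wedge p u) z z != 0.
Proof.
move=> Lx xn0 pu; have ij : i != j by apply: contraNneq pu => ->.
apply: (offdiag_nonzero Lx xn0 ij).
have wE a b : wedge p u a b = p 0 a * u 0 b * (l 0 b - l 0 a).
  rewrite /wedge !mul_mx_diag !mxE !big_ord1 !mxE; ring.
have -> : wedge p u i j + wedge p u j i =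
    (l 0 j - l 0 i) * (p 0 i * u 0 j - p 0 j * u 0 i) by rewrite !wE; ring.
by rewrite mulf_neq0 // subr_eq0 ?(inj_eq l_inj) // eq_sym.
Qed.

(** Suppose that y (1 - c G) = e G with e in E for all y in U.  The map y |-> e
    is injective because all x_i are nonzero, and U has dimension at least
    n - 1 >= 2.  Hence it is onto E, 1 - c G is invertible, and e = p is
    attained: up to a scalar, y = p G / (1 - c G) lies in U.  For c = 0 this is
    the condition on p D; otherwise y is a combination of p and of
    w = p / (l - mu), where mu is the parameter at which the member f - mu g is
    proportional to 1 - c G, and y being orthogonal to p and x yields
    p.w = 0 and wedge(p, w) = 0 at x. *)
Lemma span_through_two_points m p x : (3 <= n)%N -> m = (n - 1)./2 ->
  diag_locus l p -> diag_locus l x -> (forall i, x 0 i != 0) ->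
  dot p x != 0 -> (forall i, bf D p x != l 0 i * dot p x) ->
  bf (wedge p (p *m D)) x x != 0 ->
  (forall mu, (forall i, l 0 i != mu) -> \sum_i p 0 i ^+ 2 / (l 0 i - mu) = 0 ->
     bf (wedge p (\row_i (p 0 i / (l 0 i - mu)))) x x != 0) ->
  exists (L : 'M[K]_(m.+2, n.+3)) c, [/\ row_free L, (p <= L)%MS, (x <= L)%MS,
    (3 <= \rank (L *m L^T))%N & L *m D *m L^T = c *: (L *m L^T)].
Proof.
move=> n3 mE [p0 Dp dp] [x0 Dx dx] xn0 px gam wD wmu.
set b2 := dot p x in px gam; set b1 := bf D p x in gam.
pose E := col_mx p x.
pose G : 'M[K]_n.+3 := b2 *: D + (- b1) *: 1%:M.
have GT : G^T = G by exact: pencil_sym.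
pose g k := b2 * l 0 k - b1.
have g0 k : g k != 0 by rewrite subr_eq0 eq_sym mulrC gam.
have Gent y k : (y *m G) 0 k = y 0 k * g k by rewrite pencil_entry.
have EE : E *m E^T \in unitmx by apply: pair_gram_unit.
have EG : E *m G *m E^T = 0.
  apply: pair_gram0; rewrite // bf_pencil ?Dp ?dp ?Dx ?dx ?mulr0 ?addr0 //.
  by rewrite -/b1 -/b2; ring.
have U2 : (2 <= \rank (common_perp G E))%N.
  by apply: leq_trans (common_perp_rank GT (rank_leq_row _)); lia.
have g_inj : injective g.
  by move=> j k /addIr/(mulfI px)/l_inj.
have [||y [yU Gy dy]] := exists_third GT EE EG U2.
- move=> y v yU /sub_pairP[a [b ->]] yGv; have [yp yx _ _] := pair_common_perp yU.
  have yE : y = a *: p + b *: x.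
    by apply/rowP => k; have /rowP/(_ k) := yGv; rewrite !Gent; apply: mulIf.
  move: yp yx; rewrite yE !(bfDl, bfZl) dp dx (dotC x p) -/b2 !mulr0 add0r addr0.
  move=> /eqP + /eqP; rewrite !mulf_eq0 (negPf px) !orbF => /eqP -> /eqP ->.
  by rewrite !scale0r addr0.
- move=> c hc.
  have coords y : (y <= common_perp G E)%MS -> exists a b, forall k,
      y 0 k * (1 - c * g k) = (a * p 0 k + b * x 0 k) * g k.
    move=> yU; have [v /sub_pairP[a [b ->]] yv] := hc y yU; exists a, b => k.
    have /rowP/(_ k) := yv; rewrite row_subZ !Gent row_addZ => <-; ring.
  have ker0 y : (y <= common_perp G E)%MS -> (forall k, y 0 k * (1 - c * g k) = 0) -> y = 0.
    move=> yU; have [_ yx _ _] := pair_common_perp yU.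
    exact: kernel_support g_inj xn0 yx.
  (* at an index i where 1 - c g vanishes, e_i = 0: not all of E is attained *)
  have ns i : 1 - c * g i != 0.
    apply/negP => /eqP ci.
    have [k pk] : exists k, p 0 i * x 0 k - p 0 k * x 0 i != 0.
      apply: contrapT => /forallNP h; move/eqP: px; apply.
      have pE : p = (p 0 i / x 0 i) *: x.
        apply/rowP => k; have /negP/negPn/eqP/subr0_eq e := h k.
        by rewrite mxE mulrAC e mulfK.
      by rewrite /b2 pE bfZl dx mulr0.
    have [y [yU /eqP y0 yc]] :=
      exists_submx_ker ((1%:M - c *: G) *m (delta_mx k 0 : 'cV[K]_n.+3)) U2.
    apply: y0; have [a [b yab]] := coords y yU; apply: ker0 => // r.
    have yk : y 0 k * (1 - c * g k) = 0.
      move/matrixP/(_ 0 0): yc; rewrite mulmxA mulmxBr mulmx1 -scalemxAr -colE mxE.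
      by rewrite row_subZ Gent [RHS]mxE => <-; ring.
    have := yab i; have := yab k; rewrite yk ci mulr0 => /esym/eqP + /esym/eqP.
    rewrite !mulf_eq0 !(negPf (g0 _)) !orbF => /eqP e1 /eqP e2.
    have a0 : a = 0.
      apply: (mulIf pk); rewrite mul0r.
      transitivity (x 0 k * (a * p 0 i + b * x 0 i) - x 0 i * (a * p 0 k + b * x 0 k)).
        by ring.
      by rewrite e1 e2 !mulr0 subrr.
    have b0 : b = 0.
      by apply/eqP; move/eqP: e2; rewrite a0 mul0r add0r mulf_eq0 (negPf (xn0 i)) orbF.
    by rewrite yab a0 b0; ring.
  have [y [yU /eqP y0 yc]] :=
    (* e is orthogonal to p for this y, hence a multiple of p *)
    exists_submx_ker (\col_k ((1 - c * g k) / g k * p 0 k)) U2.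
  have [yp yx _ yGx] := pair_common_perp yU.
  have yDx : bf D y x = 0.
    move: yGx; rewrite bf_pencil yx mulr0 addr0 => /eqP.
    by rewrite mulf_eq0 (negPf px) => /eqP.
  have [a [b yab]] := coords y yU.
  have b0 : b = 0.
    apply: (mulIf px); rewrite mul0r.
    have : a * dot p p + b * dot x p = 0.
      move/matrixP/(_ 0 0): yc; rewrite [RHS]mxE mxE -!bfZl -bfDl dotE => yc.
      rewrite -[RHS]yc; apply: eq_bigr => k _; rewrite row_addZ mxE !mulrA.
      by rewrite yab mulfK.
    by rewrite dp mulr0 add0r (dotC x p).
  have ya k : y 0 k * (1 - c * g k) = a * p 0 k * g k by rewrite yab b0 mul0r addr0.
  have a0 : a != 0.
    by apply: contra_notN y0 => /eqP a0; apply: ker0 => // k; rewrite ya a0 !mul0r.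
  have [c0|c0] := eqVneq c 0.
    have yE : y = a *: (b2 *: (p *m D) + (- b1) *: p).
      apply/rowP => k; have := ya k; rewrite c0 mul0r subr0 mulr1 => ->.
      by rewrite [RHS]mxE row_addZ mul_mx_diag mxE /g; ring.
    move/eqP: wD; apply; rewrite bf_wedge; apply: (mulfI a0); rewrite mulr0 -[RHS]yDx.
    by rewrite yE bfZl bfDl !bfZl -/b2 -/b1 -bf_mulmx -/b1; ring.
  (* 1 - c G = c b2 (mu - l) *)
  pose mu := (1 + c * b1) / (c * b2).
  have cg k : 1 - c * g k = c * b2 * (mu - l 0 k).
    by rewrite /mu /g; field; rewrite c0 px.
  have lmu i : l 0 i != mu.
    by have := ns i; rewrite cg !mulf_eq0 (negPf c0) (negPf px) /= subr_eq0 eq_sym.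
  pose w : 'rV[K]_n.+3 := \row_i (p 0 i / (l 0 i - mu)).
  have wE : w = (- (c ^+ 2 * b2) / a) *: y + (- (c * b2)) *: p.
    apply/rowP => k; rewrite row_addZ mxE.
    have lk : l 0 k - mu != 0 by rewrite subr_eq0.
    have yk : y 0 k = a * p 0 k * g k / (1 - c * g k) by rewrite -ya mulfK.
    have gk : g k = (1 - c * b2 * (mu - l 0 k)) / c.
      by apply: (mulfI c0); rewrite [RHS]mulrC divfK // -cg; ring.
    rewrite yk cg gk; field.
    by rewrite a0 c0 px lk -opprB oppr_eq0 lk.
  have wp : dot w p = 0 by rewrite wE bfDl !bfZl yp dp !mulr0 addr0.
  have sum0 : \sum_i p 0 i ^+ 2 / (l 0 i - mu) = 0.
    by rewrite -[RHS]wp dotE; apply: eq_bigr => i _; rewrite mxE; ring.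
  move/eqP: (wmu mu lmu sum0); apply; rewrite bf_wedge -/w -/b1 -/b2 wE.
  by rewrite !(bfDl, bfZl) yDx yx -/b1 -/b2; ring.
- have [|||L [Lf EL LG L3]] := @span_of_third _ _ G E y 0 m.+2 GT EE EG _ yU Gy dy.
  + by rewrite addn0 rank_leq_row.
  + by lia.
  + by lia.
  have [pE xE] := pair_sub p x.
  exists L, (- - b1 / b2); split=> //; try exact: submx_trans EL.
  exact: proportional_gram LG.
Qed.

End DiagonalSpans.

(** * Back to arbitrary coordinates *)

(** Another pair of generators of the pencil, the second of them invertible. *)
Lemma unit_member_exists (K : numClosedFieldType) N (f g : 'M[K]_N.+1) :
  f^T = f -> g^T = g -> smooth_pencil f g ->
  exists f' g', [/\ f'^T = f', g'^T = g', smooth_pencil f' g', g' \in unitmx &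
    base_locus f' g' = base_locus f g].
Proof.
move=> fT gT sm; have [t tu] := pencil_member_unit fT gT sm.
have ft x : bf (f + t *: g) x x = bf f x x + t * bf g x x by rewrite bfDm bfZm.
exists g, (f + t *: g); split=> //.
- by rewrite linearD linearZ /= fT gT.
- move=> x x0 gx; rewrite ft gx mulr0 addr0 => fx a b e.
  have [|b0 ab] := sm x x0 fx gx b (a + b * t).
    by rewrite -[RHS]e mulmxDr -scalemxAr scalerDr scalerDl scalerA addrCA addrC -addrA.
  by move: ab; rewrite b0 mul0r addr0.
- apply/seteqP; split=> x; rewrite /base_locus /= ft.
    by move=> [gx]; rewrite gx mulr0 addr0.
  by move=> [fx gx]; rewrite gx fx mulr0 addr0.
Qed.

(** In three coordinates the two equations determine the squares up to a common
    factor. *)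
Lemma locus3_squares (K : numClosedFieldType) n (l : 'rV[K]_n.+3) z w :
  n = 0%N -> injective (l 0) -> diag_locus l z -> diag_locus l w ->
  z 0 ord0 ^+ 2 * w 0 (lift ord0 ord0) ^+ 2 = z 0 (lift ord0 ord0) ^+ 2 * w 0 ord0 ^+ 2.
Proof.
move=> n0; subst n => l_inj Lz Lw.
pose i1 : 'I_3 := lift ord0 ord0; pose i2 : 'I_3 := lift ord0 (lift ord0 ord0).
have l02 : l 0 ord0 - l 0 i2 != 0 by rewrite subr_eq0 (inj_eq l_inj).
have elim2 y : diag_locus l y ->
    (l 0 ord0 - l 0 i2) * y 0 ord0 ^+ 2 = (l 0 i2 - l 0 i1) * y 0 i1 ^+ 2.
  move=> [_]; rewrite bf_diag dotE !big_ord_recl !big_ord0 -/i1 -/i2 !addr0 => e1 e2.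
  have e3 : l 0 i2 * 0 = 0 by rewrite mulr0.
  rewrite -{1}e2 in e3; apply: subr0_eq; rewrite -[RHS](subrr 0) -{1}e1 -{1}e3.
  by ring.
apply: (mulfI l02); rewrite mulrA elim2 // mulrCA mulrA [in RHS]mulrCA elim2 //; ring.
Qed.

Section Transfer.
Variables (K : numClosedFieldType) (n : nat) (f g P : 'M[K]_n.+3) (l : 'rV[K]_n.+3).
Hypotheses (gT : g^T = g) (Pu : P \in unitmx) (Pg : P *m g *m P^T = 1%:M)
  (Pf : P *m f *m P^T = diag_mx l) (l_inj : injective (l 0)).
Local Notation dot := (bf 1%:M).
Let X : set (ppoint K n.+2) := base_locus f g.
Hypothesis Xvar : variety X.

Let coord (x : ppoint K n.+2) : 'rV[K]_n.+3 := val x *m invmx P.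

Let coordK x : coord x *m P = val x.
Proof. by rewrite mulmxKV. Qed.

Lemma coord_locus x : X x -> diag_locus l (coord x).
Proof.
move=> [fx gx]; split.
- by have := valP x; apply: contraNneq => e; rewrite -coordK e mul0mx.
- by rewrite -Pf bf_congr coordK.
- by rewrite -Pg bf_congr coordK.
Qed.

Lemma locus_coord z : diag_locus l z -> exists2 x, X x & coord x = z.
Proof.
move=> [z0 Dz dz]; have zP0 : z *m P != 0.
  by apply: contraNneq z0 => e; rewrite -(mulmxK Pu z) e mul0mx.
exists (exist (fun v => v != 0) _ zP0); last exact: mulmxK.
by split; rewrite /= -bf_congr ?Pf ?Pg.
Qed.

Let pull h := invmx P *m h *m (invmx P)^T.

Let bf_pull h x : bf (pull h) (val x) (val x) = bf h (coord x) (coord x).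
Proof. exact: bf_congr. Qed.

Let pull_nonzero (hs : seq 'M[K]_n.+3) :
  (forall h, h \in hs -> exists2 z, diag_locus l z & bf h z z != 0) ->
  forall h, h \in [seq pull h | h <- hs] ->
    exists2 x, X x & bf h (val x) (val x) != 0.
Proof.
move=> hne h /mapP[h' /hne[z /locus_coord[x Xx <-] hz] ->].
by exists x; rewrite ?bf_pull.
Qed.

Lemma general_of_coord_forms (hs : seq 'M[K]_n.+3) Pr :
  (forall h, h \in hs -> exists2 z, diag_locus l z & bf h z z != 0) ->
  (forall x, X x -> (forall h, h \in hs -> bf h (coord x) (coord x) != 0) -> Pr x) ->
  for_general_point X Pr.
Proof.
move=> hne hP; apply: (general_of_forms Xvar (pull_nonzero hne)) => x Xx hx.
by apply: hP => // h hhs; rewrite -bf_pull hx // map_f.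
Qed.

Lemma common_coord_point (hs : seq 'M[K]_n.+3) :
  (forall h, h \in hs -> exists2 z, diag_locus l z & bf h z z != 0) ->
  exists2 z, diag_locus l z & forall h, h \in hs -> bf h z z != 0.
Proof.
move=> hne; have [x Xx hx] := exists_common_nonzero Xvar (pull_nonzero hne).
exists (coord x); first exact: coord_locus.
by move=> h hhs; rewrite -bf_pull hx // map_f.
Qed.

Lemma quadric_of_span m (L : 'M[K]_(m.+2, n.+3)) c :
  row_free L -> (3 <= \rank (L *m L^T))%N ->
  L *m diag_mx l *m L^T = c *: (L *m L^T) ->
  exists Q, [/\ quadric m Q, Q `<=` X &
    forall x, X x -> (coord x <= L)%MS -> Q x].
Proof.
move=> Lf L3 Lc.
have LE h : (L *m P) *m h *m (L *m P)^T = L *m (P *m h *m P^T) *m L^T.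
  by rewrite trmx_mul !mulmxA.
have [||| Q [Qm QX Qx]] := @quadric_in_base_locus _ _ m f g (L *m P) c gT.
- by rewrite /row_free mxrankMfree // row_free_unit.
- by rewrite LE Pg mulmx1.
- by rewrite !LE Pf Pg mulmx1.
by exists Q; split=> // x Xx xL; apply: Qx => //; rewrite -coordK submxMr.
Qed.

Let coord_forms : seq 'M[K]_n.+3 :=
  [seq (delta_mx 0 i : 'rV[K]_n.+3)^T *m (delta_mx 0 i : 'rV[K]_n.+3) | i <- enum 'I_n.+3].

Let coord_forms_neq0 x :
  (forall h, h \in coord_forms -> bf h x x != 0) -> forall i, x 0 i != 0.
Proof.
move=> hx i; have := hx _ (map_f _ (mem_enum _ i)).
by rewrite bf_rank1 dot_delta -expr2 sqrf_eq0.
Qed.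

Lemma locus_point_all_neq0 : exists2 z, diag_locus l z & forall i, z 0 i != 0.
Proof.
have [|z Lz hz] := @common_coord_point coord_forms; last first.
  by exists z => //; apply: coord_forms_neq0.
move=> h /mapP[i _ ->]; have [//|z Lz zi] := @locus_point_neq0 _ _ l l_inj i.
by exists z => //; rewrite bf_rank1 dot_delta -expr2 sqrf_eq0.
Qed.

Lemma linear_form_neq0 (q : 'rV[K]_n.+3) : q != 0 ->
  exists2 z, diag_locus l z & bf (q^T *m q) z z != 0.
Proof. by have [z Lz zn0] := locus_point_all_neq0; apply: linear_nonzero Lz zn0. Qed.

Let coord_forms_nonzero h : h \in coord_forms ->
  exists2 z, diag_locus l z & bf h z z != 0.
Proof.
move=> /mapP[i _ ->]; apply: linear_form_neq0.
by apply/eqP => /rowP/(_ i)/eqP; rewrite !mxE !eqxx oner_eq0.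
Qed.

(** For n = 0 the base locus consists of four points exchanged by sign changes,
    and is not irreducible: with w a point of it, each of the linear forms
    z_0 w_1 + z_1 w_0 and z_0 w_1 - z_1 w_0 is nonzero somewhere, while their
    product is zero. *)
Lemma dimension_gt0 : (0 < n)%N.
Proof.
rewrite lt0n; apply/negP => /eqP n0.
have [w Lw wn0] := locus_point_all_neq0.
pose i1 : 'I_n.+3 := lift ord0 ord0.
(* the coefficients of z_0 w_1 + s z_1 w_0 *)
pose q s : 'rV[K]_n.+3 := w 0 i1 *: delta_mx 0 0 + (s * w 0 0) *: delta_mx 0 i1.
have dq s z : dot z (q s) = z 0 0 * w 0 i1 + s * (z 0 i1 * w 0 0).
  by rewrite bfDr !bfZr !dot_delta; ring.
have q0 s : q s != 0.
  apply/eqP => /rowP/(_ 0)/eqP; rewrite !mxE !eqxx /= mulr1 mulr0 addr0.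
  by rewrite (negPf (wn0 i1)).
have [|z Lz hz] := @common_coord_point [:: (q 1)^T *m q 1; (q (-1))^T *m q (-1)].
  by move=> h; rewrite !inE => /orP[] /eqP->; apply: linear_form_neq0.
have := hz _ (mem_head _ _); rewrite bf_rank1 -expr2 sqrf_eq0 => zp.
have := hz ((q (-1))^T *m q (-1)); rewrite !inE eqxx orbT => /(_ isT).
rewrite bf_rank1 -expr2 sqrf_eq0 => zm; have /eqP := mulf_neq0 zp zm; apply.
rewrite !dq; transitivity (z 0 0 ^+ 2 * w 0 i1 ^+ 2 - z 0 i1 ^+ 2 * w 0 0 ^+ 2); first by ring.
by apply/eqP; rewrite subr_eq0; apply/eqP; exact: locus3_squares n0 l_inj Lz Lw.
Qed.

Lemma general_quadric m : n = m.*2 ->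
  for_general_point X (fun x => exists Q, [/\ quadric m Q, Q x & Q `<=` X]).
Proof.
move=> nm; have m0 : (0 < m)%N by have := dimension_gt0; lia.
apply: (general_of_coord_forms coord_forms_nonzero) => x Xx /coord_forms_neq0 xn0.
have [L [c [Lf xL L3 Lc]]] := span_through_vertex l_inj nm m0 (coord_locus Xx) xn0.
have [Q [Qm QX Qx]] := quadric_of_span Lf L3 Lc.
by exists Q; split=> //; apply: Qx.
Qed.

(** Each of the conditions of [span_through_two_points] is the nonvanishing of
    the square of a linear form or of a [wedge] form.  They are not identically
    zero because p, being isotropic, has two nonzero coordinates. *)
Lemma general_quadric_through m x0 : (3 <= n)%N -> m = (n - 1)./2 -> X x0 ->
  for_general_point X (fun x => exists Q, [/\ quadric m Q, Q x0, Q x & Q `<=` X]).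
Proof.
move=> n3 mE Xx0; have [p pE] : exists p, coord x0 = p by exists (coord x0).
have Lp : diag_locus l p by rewrite -pE; apply: coord_locus.
have [p0 _ _] := Lp.
have /rV0Pn[i pi] := p0.
have [j ij pj] := locus_two_coords Lp pi.
have [rs rsP] := resolvent_roots l_inj p0.
have [xs Lxs xsn0] := locus_point_all_neq0.
pose sq (q : 'rV[K]_n.+3) : 'M[K]_n.+3 := q^T *m q.
pose res mu : 'rV[K]_n.+3 := \row_i (p 0 i / (l 0 i - mu)).
pose D := diag_mx l.
pose mus := [seq mu <- rs | [forall i, l 0 i != mu]].
pose hs := coord_forms ++
  [seq sq (p *m D - l 0 i *: p) | i <- enum 'I_n.+3] ++
  [:: sq p; wedge l p (p *m D)] ++ [seq wedge l p (res mu) | mu <- mus].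
apply: (@general_of_coord_forms hs).
  move=> h; rewrite !mem_cat => /or4P[|/mapP[k _ ->]||/mapP[mu]].
  - exact: coord_forms_nonzero.
  - apply: linear_form_neq0; apply/negP => /eqP/rowP pDk.
    have pk r : (l 0 r - l 0 k) * p 0 r = 0.
      by have := pDk r; rewrite mul_mx_diag !mxE => <-; ring.
    have := pk i; have := pk j => /eqP + /eqP.
    rewrite !mulf_eq0 (negPf pi) (negPf pj) !orbF !subr_eq0 !(inj_eq l_inj).
    by move=> /eqP jk /eqP ik; rewrite ik jk eqxx in ij.
  - rewrite !inE => /orP[] /eqP->; first exact: linear_form_neq0.
    apply: (wedge_nonzero l_inj (i := i) (j := j) Lxs xsn0).
    rewrite mul_mx_diag !mxE -subr_eq0.
    have -> : p 0 i * (p 0 j * l 0 j) - p 0 j * (p 0 i * l 0 i) =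
      p 0 i * p 0 j * (l 0 j - l 0 i) by ring.
    by rewrite !mulf_neq0 // subr_eq0 (inj_eq l_inj) eq_sym.
  - rewrite mem_filter => /andP[/forallP lmu _] ->.
    apply: (wedge_nonzero l_inj (i := i) (j := j) Lxs xsn0).
    have li : l 0 i - mu != 0 by rewrite subr_eq0.
    have lj : l 0 j - mu != 0 by rewrite subr_eq0.
    rewrite !mxE -subr_eq0.
    have -> : p 0 i * (p 0 j / (l 0 j - mu)) - p 0 j * (p 0 i / (l 0 i - mu)) =
      p 0 i * p 0 j * (l 0 i - l 0 j) / ((l 0 i - mu) * (l 0 j - mu)).
      by field; rewrite li lj.
    by rewrite !mulf_neq0 ?invr_neq0 ?mulf_neq0 // subr_eq0 (inj_eq l_inj).
move=> x Xx hx.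
have Lx := coord_locus Xx.
have [|||||L [c [Lf pL xL L3 Lc]]] :=
  @span_through_two_points _ _ l l_inj m p (coord x) n3 mE Lp Lx.
- by apply: coord_forms_neq0 => h hh; apply: hx; rewrite mem_cat hh.
- have := hx (sq p); rewrite !mem_cat !inE eqxx !orbT => /(_ isT).
  by rewrite bf_rank1 -expr2 sqrf_eq0 dotC.
- move=> k; have := hx (sq (p *m D - l 0 k *: p)).
  rewrite !mem_cat (map_f (fun k => sq (p *m D - l 0 k *: p))) ?mem_enum // !orbT => /(_ isT).
  rewrite bf_rank1 -expr2 sqrf_eq0 dotC -scaleN1r !bfDl !bfZl -bf_mulmx mulN1r.
  by rewrite subr_eq0.
- by have := hx (wedge l p (p *m D)); rewrite !mem_cat !inE eqxx !orbT => /(_ isT).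
- move=> mu lmu mu0; apply: (hx (wedge l p (res mu))).
  rewrite !mem_cat (map_f (fun mu => wedge l p (res mu))) ?orbT // mem_filter rsP // andbT.
  exact/forallP.
have [Q [Qm QX Qx]] := quadric_of_span Lf L3 Lc.
by exists Q; split=> //; apply: Qx; rewrite ?pE.
Qed.

End Transfer.

Theorem proposition3p1 (R : realType) (n : nat)
    (X : set (ppoint R[i] n.+2)) (X1 X2 : {mpoly R[i][n.+3]})
    (hX1 : hyperquadric_eqn X1) (hX2 : hyperquadric_eqn X2)
    (hX : variety X) (hci : complete_intersection X X1 X2)
    (hsm : smooth X) :
  [/\ forall Q : set (ppoint R[i] n.+2),
        quadric (n./2 + 1) Q -> ~ (Q `<=` X),
      ~~ odd n ->
        for_general_point X (fun x =>
          exists Q : set (ppoint R[i] n.+2),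
            [/\ quadric n./2 Q, Q x & Q `<=` X]) &
      (3 <= n)%N -> forall x0 : ppoint R[i] n.+2, X x0 ->
        for_general_point X (fun x =>
          exists Q : set (ppoint R[i] n.+2),
            [/\ quadric (n - 1)./2 Q, Q x0, Q x & Q `<=` X])].
Proof.
have [[_ /homog2_quadpoly[f1 f1T X1E]] [_ /homog2_quadpoly[f2 f2T X2E]]] := (hX1, hX2).
have [dimX sat] := hci; rewrite X1E X2E in sat.
have [Xcl _ _] := hX; have XE := base_locus_eq Xcl sat.
have sm12 := smooth_pencil_of_smooth f1T f2T XE dimX sat hsm.
have [f [g [fT gT sm gu fgX]]] := unit_member_exists f1T f2T sm12.
rewrite -fgX in XE; subst X.
have [P [l [Pu Pg Pf l_inj]]] := smooth_pencil_diag fT gT sm gu.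
split.
- by move=> Q; apply: quadric_notin_base_locus.
- move=> n_even; apply: (general_quadric gT Pu Pg Pf l_inj hX).
  by rewrite -[LHS]odd_double_half (negPf n_even).
- move=> n3 x0 Xx0.
  exact: (general_quadric_through gT Pu Pg Pf l_inj hX n3 erefl Xx0).
Qed.
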